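(* Let $n\ge 2$, let $\Omega\subseteq\mathbb{R}^n$ be a bounded open set with $|\partial\Omega|<+\infty$, and let $x_0\in\Omega$. If there exists a point $z\in T(\partial\Omega,x_0)$ such that $S_z(\partial\Omega,x_0)\leq 1$, then $$\mathcal{K}(\partial\Omega,x_0)\ \geq\ \frac{|\partial\Omega|-|\partial B|}{|\partial\Omega|},$$ where $B:=B(x_0,r)$ is the Euclidean ball with $r:=\mathrm{dist}(x_0,\partial\Omega)$.
   Context: Notation: $\sigma$ is the $(n-1)$-dimensional Hausdorff measure in $\mathbb{R}^n$, $|\partial\Omega|$ and $|\partial B|$ denote the $(n-1)$-Hausdorff measures of these topological boundaries, $\fint_{\partial\Omega}u\,d\sigma=\frac1{|\partial\Omega|}\int_{\partial\Omega}u\,d\sigma$, $\omega_n$ is the Lebesgue measure of the unit ball of $\mathbb{R}^n$, $B(x,\rho)$ is the open Euclidean ball. Touching set: for $\Omega$ open and $x_0\in\Omega$, $T(\partial\Omega,x_0):=\{z\in\partial\Omega: |x_0-z|=\mathrm{dist}(\partial\Omega,x_0)\}$. Kuran function: for $\alpha\in\mathbb{R}^n$, $k_\alpha(x):=1+h_\alpha(x)$, where $h_\alpha(x):=|\alpha|^{n-2}\frac{|x|^2-|\alpha|^2}{|x-\alpha|^n}$, $x\in\mathbb{R}^n\setminus\{\alpha\}$. Kuran gap: if $0\in\Omega$, $\mathcal{K}(\partial\Omega,0):=\sup_{\alpha\notin\overline\Omega}\left|k_\alpha(0)-\fint_{\partial\Omega}k_\alpha\,d\sigma\right|=\sup_{\alpha\notin\overline\Omega}\left|\fint_{\partial\Omega}k_\alpha\,d\sigma\right|$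 (note $k_\alpha(0)=0$). For general $x_0\in\Omega$, $\mathcal{K}(\partial\Omega,x_0):=\mathcal{K}(-x_0+\partial\Omega,0)$, the gap at $0$ of the translated set $-x_0+\Omega$. It takes values in $[0,+\infty]$. Spherical flatness index: let $\Omega$ be open with every compact subset of $\partial\Omega$ of finite $(n-1)$-Hausdorff measure, $x_0\in\Omega$, $z\in T(\partial\Omega,x_0)$, $r:=|z-x_0|$. Then $$S_z(\partial\Omega,x_0):=\frac{2}{n\omega_n r}\liminf_{R\searrow0}\left(\liminf_{\alpha\to z,\ \alpha\notin\overline\Omega}\int_{\partial\Omega\cap B(z,R)}\frac{\langle\alpha-x,\alpha-x_0\rangle}{|x-\alpha|^n}\,d\sigma(x)\right)\in[-\infty,+\infty],$$ where the inner $\liminf$ is $+\infty$ (the standard convention $\inf\emptyset=+\infty$) if no points $\alpha\notin\overline\Omega$ converge to $z$. *)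

(* Defs.v *)
From HB Require Import structures.
From mathcomp Require Import all_boot all_order all_algebra.
From mathcomp Require Import all_classical all_reals all_analysis.

Set Implicit Arguments.
Unset Strict Implicit.
Unset Printing Implicit Defensive.

Import Order.TTheory GRing.Theory Num.Theory.
Import numFieldNormedType.Exports.

Local Open Scope classical_set_scope.
Local Open Scope ring_scope.

(* Points of R^n are row vectors.  The library's norm on 'rV[R]_n is the sup
   norm; it induces the same topology and the same bounded sets as the Euclidean
   norm, so open, closure, nbhs and bounded_set below are the library's, while
   every metric quantity uses enorm. *)
Section euclidean.
Variables (R : realType) (n : nat).
Implicit Types (x y : 'rV[R]_n) (A : set 'rV[R]_n).

Definition dotp x y : R := \sum_(i < n) x ord0 i * y ord0 i.

Definition enorm x : R := Num.sqrt (dotp x x).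

Definition eball x (rho : R) : set 'rV[R]_n := [set y | enorm (y - x) < rho].

Definition edistance x A : R := inf [set enorm (x - y) | y in A].

(* -oo on the empty set *)
Definition ediam A : \bar R :=
  ereal_sup [set (enorm (p.1 - p.2))%:E | p in A `*` A].

Definition frontier A : set 'rV[R]_n := closure A `\` interior A.

End euclidean.

(* The n-fold product of the Lebesgue measure on R, i.e. the library's
   product_measure1 unfolded and iterated; for Borel A this is the Lebesgue
   measure of A. *)
Fixpoint lebesgue_rV (R : realType) (n : nat) : set 'rV[R]_n -> \bar R :=
  match n with
  | 0%N => fun A => (((0 : 'rV[R]_0) \in A)%:R)%:E
  | n'.+1 => fun A =>
      (\int[@lebesgue_measure R]_t
         lebesgue_rV [set v : 'rV[R]_n' | A (row_mx (const_mx t : 'rV[R]_1) v)])%E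
  end.

Definition omega (R : realType) (n : nat) : R :=
  fine (lebesgue_rV (eball (0 : 'rV[R]_n) 1)).

Section hausdorff.
Variables (R : realType) (n k : nat).
Implicit Types (A E : set 'rV[R]_n) (F : (set 'rV[R]_n)^nat).
Local Open Scope ereal_scope.

(* The constant omega_k / 2^k is the usual normalization, for which the
   k-dimensional Hausdorff measure is the Lebesgue measure on k-planes.  The
   empty set is singled out so that it costs 0 also when k = 0. *)
Definition hausdorff_gauge E : \bar R :=
  if E == set0 then 0 else (omega R k / 2 ^+ k)%:E * ediam E ^+ k.

Definition delta_cover (delta : R) A F : Prop :=
  A `<=` \bigcup_i F i /\ forall i, ediam (F i) <= delta%:E.

Definition hausdorff_delta (delta : R) A : \bar R :=
  ereal_inf [set \sum_(i <oo) hausdorff_gauge (F i) | F in delta_cover delta A].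

(* The supremum over delta is the limit as delta tends to 0. *)
Definition hausdorff A : \bar R :=
  ereal_sup [set hausdorff_delta delta A | delta in [set d : R | (0 < d)%R]].

End hausdorff.

Section hausdorff_outer_measure.
Variables (R : realType) (n k : nat).
Implicit Types (A E : set 'rV[R]_n) (F : (set 'rV[R]_n)^nat).
Local Open Scope ereal_scope.

Lemma lebesgue_rV_ge0 m (A : set 'rV[R]_m) : 0 <= lebesgue_rV A.
Proof.
elim: m A => [|m IH] A /=; first by rewrite lee_fin ler0n.
by apply: integral_ge0 => t _; exact: IH.
Qed.

Lemma omega_ge0 m : (0 <= omega R m)%R.
Proof. exact/fine_ge0/lebesgue_rV_ge0. Qed.

Lemma ediam_ge0 E : E !=set0 -> 0 <= ediam E.
Proof.
move=> [x Ex]; apply: le_trans (ereal_sup_ubound _); last first.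
  by exists (x, x).
by rewrite lee_fin sqrtr_ge0.
Qed.

Lemma hausdorff_gauge_ge0 E : 0 <= hausdorff_gauge k E.
Proof.
rewrite /hausdorff_gauge; case: eqVneq => // /set0P E0.
apply: mule_ge0; first by rewrite lee_fin divr_ge0 ?omega_ge0 // exprn_ge0.
exact/expe_ge0/ediam_ge0.
Qed.

Lemma hausdorff_gauge0 : hausdorff_gauge k (set0 : set 'rV[R]_n) = 0.
Proof. by rewrite /hausdorff_gauge eqxx. Qed.

Lemma hausdorff_delta_ge0 delta A : 0 <= hausdorff_delta k delta A.
Proof.
apply: le_ereal_inf_tmp => _ [F _ <-].
by apply: nneseries_ge0 => i _ _; exact: hausdorff_gauge_ge0.
Qed.

Lemma hausdorff_delta0 delta : hausdorff_delta k delta (set0 : set 'rV[R]_n) = 0.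
Proof.
apply/eqP; rewrite eq_le hausdorff_delta_ge0 andbT.
apply: ereal_inf_lbound; exists (fun=> set0).
  split=> [//|i]; rewrite /ediam (_ : [set _ | _ in _] = set0) ?ereal_sup0 ?leNye//.
  by rewrite -subset0 => _ [p [[]]].
by rewrite eseries0// => i _ _; rewrite hausdorff_gauge0.
Qed.

Lemma hausdorff_delta_sigma_subadditive delta :
  sigma_subadditive (hausdorff_delta k delta : set 'rV[R]_n -> \bar R).
Proof.
move=> A; set H := hausdorff_delta k delta.
have H0 : forall B, 0 <= H B by move=> B; exact: hausdorff_delta_ge0.
have [[i ioo]|] := pselect (exists i, H (A i) = +oo).
  rewrite (eseries_pinfty _ _ ioo) ?leey// => m _.
  by rewrite -ltNye (lt_le_trans _ (H0 _)).
rewrite -forallNE => Aoo.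
suff add2e (e : {posnum R}) :
    H (\bigcup_m A m) <= \sum_(i <oo) H (A i) + e%:num%:E.
  by apply/lee_addgt0Pr => _/posnumP[].
rewrite (le_trans _ (epsilon_trick _ _ _))//.
pose P m B := delta_cover delta (A m) B /\
  \sum_(j <oo) hausdorff_gauge k (B j) <= H (A m) + (e%:num / (2 ^ m.+1)%:R)%:E.
have [G PG] : {G : ((set 'rV[R]_n)^nat)^nat & forall m, P m (G m)}.
  apply: (@choice _ _ P) => m; rewrite /P.
  have Hfin : H (A m) \is a fin_num.
    by rewrite ge0_fin_numE// ltey; apply/eqP; exact: Aoo.
  have en1 : (0 < e%:num / (2 ^ m.+1)%:R)%R by [].
  have [_ [B cB <-] xS] := lb_ereal_inf_adherent en1 Hfin.
  by exists B; split => //; exact: ltW.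
pose g := fun x : nat * nat => hausdorff_gauge k (G x.1 x.2).
have g_ge0 x : 0 <= g x by exact: hausdorff_gauge_ge0.
apply: (@le_trans _ _ (\esum_(i in setT) g i)).
  apply: ereal_inf_lbound => /=.
  have /card_esym/ppcard_eqP[f] := card_nat2.
  exists (fun i => G (f i).1 (f i).2).
    split=> [t [i _ Ait]|i]; last exact: (PG (f i).1).1.2.
    have [j _ Gijt] := (PG i).1.1 _ Ait.
    by exists (f^-1%FUN (i, j)) => //=; rewrite invK ?inE.
  by rewrite (reindex_esum setT setT f)// -nneseries_esumT.
rewrite (_ : esum _ _ = \sum_(i <oo) \sum_(j <oo) g (i, j)); last first.
  rewrite nneseries_esumT; last by move=> i; exact: nneseries_ge0.
  rewrite [RHS](eq_esum (b := fun i => \esum_(j in setT) g (i, j))); last first.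
    by move=> i _; exact: (nneseries_esumT (a := fun j => g (i, j))).
  rewrite esum_esum//=.
  rewrite (_ : [set: nat] `*`` _ = setT); last by rewrite predeqE => -[].
  by apply: eq_esum => -[].
apply: lee_nneseries => [m _ _|m _]; first exact: nneseries_ge0.
exact: (PG m).2.
Qed.

Lemma hausdorff0 : hausdorff k (set0 : set 'rV[R]_n) = 0.
Proof.
rewrite /hausdorff (_ : [set _ | _ in _] = [set 0]) ?ereal_sup1//.
rewrite predeqE => x; split=> [[d _ <-]|->]; first exact: hausdorff_delta0.
by exists 1%R; [exact: ltr01|exact: hausdorff_delta0].
Qed.

Lemma hausdorff_ge0 A : 0 <= hausdorff k A.
Proof.
apply: le_trans (ereal_sup_ubound _); last by exists 1%R; first exact: ltr01.
exact: hausdorff_delta_ge0.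
Qed.

Lemma le_hausdorff : {homo @hausdorff R n k : A B / A `<=` B >-> A <= B}.
Proof.
move=> A B AB; apply: ge_ereal_sup => _ [d d0 <-].
apply: le_trans (ereal_sup_ubound _); last by exists d.
apply: le_ereal_inf_tmp => _ [F [BF Fd] <-]; apply: ereal_inf_lbound.
by exists F => //; split=> //; exact: subset_trans BF.
Qed.

Lemma hausdorff_sigma_subadditive : sigma_subadditive (@hausdorff R n k).
Proof.
move=> A; apply: ge_ereal_sup => _ [d d0 <-].
apply: (le_trans (hausdorff_delta_sigma_subadditive d A)).
apply: lee_nneseries => [m _ _|m _]; first exact: hausdorff_delta_ge0.
by apply: ereal_sup_ubound; exists d.
Qed.

HB.instance Definition _ := isOuterMeasure.Build R 'rV[R]_n (@hausdorff R n k)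
  hausdorff0 hausdorff_ge0 le_hausdorff hausdorff_sigma_subadditive.

End hausdorff_outer_measure.

(* The surface measure, on the Caratheodory sigma-algebra of the Hausdorff
   outer measure (which contains the Borel sets). *)
Definition hausdorff_outer (R : realType) (n k : nat) :
    {outer_measure set 'rV[R]_n -> \bar R} := @hausdorff R n k.

Definition sigma (R : realType) (n : nat) :
    {measure set (caratheodory_type (hausdorff_outer R n n.-1)) -> \bar R} :=
  hausdorff_outer R n n.-1.

Arguments sigma {R n}.

Section kuran.
Variables (R : realType) (n : nat).
Implicit Types (x z alpha : 'rV[R]_n) (Omega : set 'rV[R]_n).

Definition touching Omega x0 : set 'rV[R]_n :=
  [set z | frontier Omega z /\ enorm (x0 - z) = edistance x0 (frontier Omega)].

Definition surface_average Omega (u : 'rV[R]_n -> R) : \bar R :=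
  ((sigma (frontier Omega))^-1 *
     \int[sigma]_(x in frontier Omega) (u x)%:E)%E.

Definition kuran_h alpha x : R :=
  enorm alpha ^+ (n - 2) * ((enorm x ^+ 2 - enorm alpha ^+ 2)
                              / enorm (x - alpha) ^+ n).

Definition kuran_fun alpha x : R := 1 + kuran_h alpha x.

(* The gaps are written as functions of Omega, not of its boundary, because the
   exterior of Omega enters the supremum. *)
Definition kuran_gap0 Omega : \bar R :=
  ereal_sup [set `|(kuran_fun alpha 0)%:E
                   - surface_average Omega (kuran_fun alpha)|%E
            | alpha in ~` closure Omega].

Definition kuran_gap Omega x0 : \bar R :=
  kuran_gap0 [set x - x0 | x in Omega].

(* When z is not a limit of exterior points, the filter of the inner liminf
   contains set0 and the liminf is +oo. *)
Definition spherical_flatness Omega x0 z : \bar R :=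
  ((2 / (n%:R * omega R n * enorm (z - x0)))%:E *
   limf_einf (fun rad : R =>
     limf_einf (fun alpha : 'rV[R]_n =>
       \int[sigma]_(x in frontier Omega `&` eball z rad)
         (dotp (alpha - x) (alpha - x0) / enorm (x - alpha) ^+ n)%:E)
       (within (~` closure Omega) (nbhs z)))
     0^'+)%E.

End kuran.

(* Main.v *)
Require Import Defs.
From HB Require Import structures.
From mathcomp Require Import all_boot all_order all_algebra.
From mathcomp Require Import all_classical all_reals all_analysis.
From mathcomp Require Import measurable_realfun.
From mathcomp Require Import ring lra.

(** Let D be the boundary of Omega, r the distance from x0 to D, and z a
    touching point. For alpha outside the closure of Omega put
    a = alpha - x0. Expanding |y - x0|^2 = |a + (y - alpha)|^2, one finds that
    the Kuran function at y is 1 + h with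
      h = |a|^(n-2) (|y - alpha|^(2-n) - 2 <alpha - y, a> / |y - alpha|^n).
    On D inside a small ball B(z, R) the first term is dropped, so that the
    integral of h is at least -2 |a|^(n-2) times the integral defining the
    spherical flatness; on D outside B(z, R) one has |y - x0| >= r, and |a|
    tends to r as alpha tends to z, so h is bounded below by a quantity that
    vanishes in the limit. Flatness at most 1 provides R and points alpha
    near z for which the flatness integral is at most n omega_n r / 2 up to
    epsilon, hence
      K(D, x0) >= 1 - n omega_n r^(n-1) / |D|
    (kuran_integral_ge, flatness_witness, kuran_gap_ge).

    It remains to see that the sphere of radius r has surface measure at least
    n omega_n r^(n-1), where the surface measure is built from coverings by
    arbitrary sets (sphere_le_hausdorff). If sets F_i of small diameters d_i
    cover the sphere, the cones over them cover the unit ball, so omega_n is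
    at most the sum of the volumes of these cones. A reflection puts the axis
    of a cone along the first coordinate; the slice at height t then has
    diameter at most about t d_i / r, and the isodiametric inequality in
    dimension n - 1 bounds its volume by omega_(n-1) (t d_i / 2r)^(n-1).
    As t^(n-1) has integral 1 / n over [0, 1], the volume of the cone is at
    most about the Hausdorff cost of F_i divided by n r^(n-1)
    (vol_cone, ball_le_gauge_series).

    The isodiametric inequality follows from the Brunn-Minkowski inequality
    applied to K and -K, whose Minkowski sum lies in a ball of radius diam K.
    Brunn-Minkowski is proved in multiplicative form by induction on the
    dimension, each step being the one-dimensional Prekopa-Leindler inequality
    for the volumes of slices. Scaling and reflection invariance of the
    Lebesgue measure come from its uniqueness, up to a factor, among
    translation invariant measures (shift_invariant_proportional). Finally,
    the integrals over D make sense because closed sets are Caratheodory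
    measurable for every Hausdorff measure (closed_caratheodory). *)

Set Implicit Arguments.
Unset Strict Implicit.
Unset Printing Implicit Defensive.

Import Order.TTheory GRing.Theory Num.Theory.
Import numFieldNormedType.Exports.

Local Open Scope classical_set_scope.
Local Open Scope ring_scope.

(** * Lebesgue measure of R^n as an iterated integral *)

Lemma product_sigma_finite d1 d2 (T1 : measurableType d1)
    (T2 : measurableType d2) (R : realType)
    (mu : {sigma_finite_measure set T1 -> \bar R})
    (nu : {sigma_finite_measure set T2 -> \bar R}) :
  exists M : {sigma_finite_measure set (T1 * T2)%type -> \bar R},
    M = (mu \x nu)%E :> (set _ -> _).
Proof.
pose m : {measure set (T1 * T2)%type -> \bar R} := (mu \x nu)%E.
have sm : sigma_finite setT m.
  have /sigma_finiteP[F [TF ndF Foo]] := sigma_finiteT mu.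
  have /sigma_finiteP[G [TG ndG Goo]] := sigma_finiteT nu.
  exists (fun k => F k `*` G k).
    apply/esym/seteqP; split=> // x _ /=.
    have [[i _ Fi] [j _ Gj]] : (\bigcup_k F k) x.1 /\ (\bigcup_k G k) x.2.
      by rewrite -TF -TG.
    exists (maxn i j) => //; split.
    - by move: Fi; exact/subsetPset/ndF/leq_maxl.
    - by move: Gj; exact/subsetPset/ndG/leq_maxr.
  move=> k; have [mF ltF] := Foo k; have [mG ltG] := Goo k; split.
    exact: measurableX.
  suff -> : m (F k `*` G k) = (mu (F k) * nu (G k))%E.
    by rewrite lte_mul_pinfty// ge0_fin_numE.
  exact: product_measure1E.
by exists (HB.pack_for {sigma_finite_measure set (T1 * T2)%type -> \bar R}
  (m : set _ -> _) (Measure.on m) (Measure_isSigmaFinite.Build _ _ _ m sm)).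
Qed.

Lemma pushforward_sigma_finite d1 d2 (T1 : measurableType d1)
    (T2 : measurableType d2) (R : realType)
    (mu : {sigma_finite_measure set T1 -> \bar R}) (f : T1 -> T2) (g : T2 -> T1) :
  measurable_fun setT f -> measurable_fun setT g -> cancel f g ->
  exists M : {sigma_finite_measure set T2 -> \bar R},
    M = pushforward mu f :> (set _ -> _).
Proof.
move=> mf mg fK; pose M : {measure set T2 -> \bar R} :=
  measure_function_pushforward__canonical__measure_function_Measure mu mf.
have sM : sigma_finite setT M.
  have /sigma_finiteP[F [TF _ Foo]] := sigma_finiteT mu.
  exists (fun k => g @^-1` F k); first by rewrite -preimage_bigcup -TF.
  move=> k; have [mF ltF] := Foo k; split.
    by rewrite -[X in measurable X]setTI; exact: mg.
  suff -> : M (g @^-1` F k) = mu (F k) by [].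
  by congr (mu _); apply/funext => p; rewrite /preimage /mkset fK.
by exists (HB.pack_for {sigma_finite_measure set T2 -> \bar R}
  (M : set _ -> _) (Measure.on M) (Measure_isSigmaFinite.Build _ _ _ M sM)).
Qed.

Section coordinate_space.
Context (R : realType).

Definition coord_cylinders n : set (set 'rV[R]_n) :=
  [set A | exists i, exists2 B : set (measurableTypeR R),
     measurable B & A = (fun x : 'rV[R]_n => x ord0 i) @^-1` B].

(** The sigma-algebra generated by the coordinates makes maps into R^n
    measurable as soon as their coordinates are; it contains the open sets by
    [open_measurable_space]. *)
Definition space n := g_sigma_algebraType (@coord_cylinders n).

Lemma measurable_coord n (i : 'I_n) :
  measurable_fun [set: space n] (fun x : 'rV[R]_n => x ord0 i : measurableTypeR R).
Proof.
move=> _ B mB; rewrite setTI; apply: sub_sigma_algebra.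
by exists i; exists B.
Qed.

Lemma measurable_to_space d (T : measurableType d) n (f : T -> space n) :
  (forall i, measurable_fun setT
     (fun t => (f t : 'rV[R]_n) ord0 i : measurableTypeR R)) ->
  measurable_fun setT f.
Proof.
move=> mf; apply: measurability => //.
move=> _ [_ [i [B mB ->]] <-]; rewrite setTI.
by rewrite -[X in measurable X]setTI; exact: mf.
Qed.

(** The splitting R^(n+1) = R x R^n used by [lebesgue_rV]. *)
Definition row_cons n (p : measurableTypeR R * space n) : space n.+1 :=
  row_mx (const_mx p.1 : 'rV_1) p.2.

Lemma row_cons0 n p : (@row_cons n p : 'rV_n.+1) ord0 ord0 = p.1.
Proof.
have := row_mxEl (const_mx p.1 : 'rV_1) (p.2 : 'rV_n) ord0 ord0.
rewrite [X in _ = X]mxE => h; apply: etrans h.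
by congr fun_of_matrix; exact: val_inj.
Qed.

Lemma row_consS n p i :
  (@row_cons n p : 'rV_n.+1) ord0 (lift ord0 i) = (p.2 : 'rV_n) ord0 i.
Proof.
have h := row_mxEr (const_mx p.1 : 'rV_1) (p.2 : 'rV_n) ord0 i.
by apply: etrans h; congr fun_of_matrix; exact: val_inj.
Qed.

Lemma measurable_row_cons n : measurable_fun setT (@row_cons n).
Proof.
apply: measurable_to_space => i.
have [j ->|->] := unliftP ord0 i.
  under eq_fun do rewrite row_consS.
  exact: (measurableT_comp (measurable_coord j) measurable_snd).
under eq_fun do rewrite row_cons0.
exact: measurable_fst.
Qed.

Definition row_split n (x : space n.+1) : measurableTypeR R * space n :=
  ((x : 'rV_n.+1) ord0 ord0, \row_(i < n) (x : 'rV_n.+1) ord0 (lift ord0 i)).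

Lemma row_consK n : cancel (@row_cons n) (@row_split n).
Proof.
move=> p; rewrite /row_split row_cons0 [RHS]surjective_pairing; congr pair.
by apply/rowP => i; rewrite mxE row_consS.
Qed.

Lemma row_splitK n : cancel (@row_split n) (@row_cons n).
Proof.
move=> x; apply/rowP => i; have [j ->|->] := unliftP ord0 i.
  by rewrite row_consS mxE.
by rewrite row_cons0.
Qed.

Lemma measurable_row_split n : measurable_fun setT (@row_split n).
Proof.
apply: measurable_fun_pair; first exact: measurable_coord.
apply: measurable_to_space => i; under eq_fun do rewrite mxE.
exact: measurable_coord.
Qed.

(** [lebesgue_rV] in dimension n + 1 is, by definition, the product of the
    Lebesgue measure of the line with [lebesgue_rV] in dimension n, transported
    by [row_cons]. *)
Lemma lebesgue_rV_sigma_finite n :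
  exists nu : {sigma_finite_measure set (space n) -> \bar R},
  forall A, nu A = lebesgue_rV A.
Proof.
elim: n => [|n [nu nuE]].
  pose o : space 0 := (0 : 'rV[R]_0); exists (dirac o) => A.
  exact: diracE.
have [m mE] := product_sigma_finite (@lebesgue_measure R) nu.
have [M ME] := pushforward_sigma_finite m (@measurable_row_cons n)
  (@measurable_row_split n) (@row_consK n).
exists M => A; rewrite ME /pushforward mE.
apply: eq_integral => t _ /=; rewrite nuE; congr lebesgue_rV.
by apply/seteqP; split=> v; rewrite /xsection /= inE.
Qed.

Definition vol n : {sigma_finite_measure set (space n) -> \bar R} :=
  projT1 (cid (lebesgue_rV_sigma_finite n)).

Lemma volE n (A : set 'rV[R]_n) : vol n A = lebesgue_rV A.
Proof. by rewrite /vol; case: cid. Qed.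

Definition slice n (A : set (space n.+1)) t : set (space n) :=
  [set v | A (row_cons (t, v))].

Lemma vol_slice n (A : set (space n.+1)) :
  vol n.+1 A = (\int[lebesgue_measure]_t vol n (slice A t))%E.
Proof. by rewrite volE /=; apply: eq_integral => t _; rewrite volE. Qed.

Let xsection_row_cons n (A : set (space n.+1)) t :
  xsection (@row_cons n @^-1` A) t = slice A t.
Proof. by apply/seteqP; split=> v; rewrite /xsection /= inE. Qed.

Lemma measurable_row_cons_preimage n (A : set (space n.+1)) :
  measurable A -> measurable (@row_cons n @^-1` A).
Proof.
by move=> mA; rewrite -[X in measurable X]setTI; exact: measurable_row_cons.
Qed.

Lemma measurable_slice n (A : set (space n.+1)) t :
  measurable A -> measurable (slice A t).
Proof.
move=> mA; rewrite -xsection_row_cons.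
by apply: measurable_xsection; exact: measurable_row_cons_preimage.
Qed.

Lemma measurable_vol_slice n (A : set (space n.+1)) : measurable A ->
  measurable_fun [set: measurableTypeR R] (vol n \o slice A).
Proof.
move=> mA; rewrite (_ : vol n \o slice A = vol n \o xsection (@row_cons n @^-1` A)).
  by apply: measurable_fun_xsection; exact: measurable_row_cons_preimage.
by apply/funext => t /=; rewrite xsection_row_cons.
Qed.

(** Half-open intervals determine the Lebesgue measure. *)
Lemma lebesgue_preserved (g : measurableTypeR R -> measurableTypeR R) :
  measurable_fun setT g ->
  (forall X, ocitv X -> @lebesgue_measure R (g @^-1` X) = lebesgue_measure X) ->
  forall A, measurable A -> @lebesgue_measure R (g @^-1` A) = lebesgue_measure A.
Proof.
move=> mg gE A mA; pose M : {measure set (measurableTypeR R) -> \bar R} :=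
  measure_function_pushforward__canonical__measure_function_Measure
    (@lebesgue_measure R) mg.
have ME : lebesgue_measure A = M A.
  by apply: lebesgue_measure_unique mA => X oX; exact/esym/gE.
exact/esym/ME.
Qed.

Lemma preserved_integral (g : measurableTypeR R -> measurableTypeR R)
    (f : measurableTypeR R -> \bar R) :
  measurable_fun setT g -> measurable_fun setT f -> (forall t, 0 <= f t)%E ->
  (forall A, measurable A -> @lebesgue_measure R (g @^-1` A) = lebesgue_measure A) ->
  (\int[lebesgue_measure]_t f (g t) = \int[lebesgue_measure]_t f t)%E.
Proof.
move=> mg mf f0 gE.
have := ge0_integral_pushforward mg (@lebesgue_measure R) measurableT mf.
rewrite preimage_setT => <-; last by move=> *; exact: f0.
by apply: eq_measure_integral => A mA _; exact: gE.
Qed.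

Lemma measurable_shift (a : R) :
  measurable_fun setT (fun t : measurableTypeR R => t + a : measurableTypeR R).
Proof. exact: measurable_funD. Qed.

Lemma lebesgue_shift (a : R) (A : set (measurableTypeR R)) : measurable A ->
  lebesgue_measure ((fun t => t + a) @^-1` A) = lebesgue_measure A.
Proof.
apply: lebesgue_preserved; first exact: measurable_shift.
move=> _ [[x y] _ <-].
rewrite (_ : _ @^-1` _ = `](x - a), (y - a)]%classic).
  rewrite !lebesgue_measure_itv /= !lte_fin ltrBlDr subrK.
  by case: ifP => // _; rewrite -!EFinB; congr EFin; ring.
by apply/seteqP; split=> t; rewrite /= !in_itv /= ltrBlDr lerBrDr.
Qed.

Lemma lebesgue_opp (A : set (measurableTypeR R)) : measurable A ->
  lebesgue_measure ((fun t => - t) @^-1` A) = lebesgue_measure A.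
Proof.
apply: lebesgue_preserved; first exact: measurableT_comp.
move=> _ [[x y] _ <-].
rewrite (_ : _ @^-1` _ = `[(- y), (- x)[%classic).
  rewrite !lebesgue_measure_itv /= !lte_fin ltrN2.
  by case: ifP => // _; rewrite -!EFinB; congr EFin; ring.
by apply/seteqP; split=> t; rewrite /= !in_itv /= lerNl ltrNr andbC.
Qed.

Lemma vol_shift n (a : 'rV[R]_n) (A : set (space n)) : measurable A ->
  vol n ((fun x : 'rV[R]_n => x + a) @^-1` A) = vol n A.
Proof.
elim: n a A => [|n IH] a A mA.
  by congr (vol 0 _); apply/funext => x; congr A; apply/rowP => -[].
rewrite !vol_slice.
pose b : measurableTypeR R * space n := row_split (a : space n.+1).
rewrite -[RHS](preserved_integral (measurable_shift b.1)
  (measurable_vol_slice mA) _ (@lebesgue_shift b.1)) //.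
apply: eq_integral => t _; rewrite -[RHS](IH b.2); last exact: measurable_slice.
congr (vol n _); apply/funext => v; congr (A _).
have -> : a = row_cons b by rewrite row_splitK.
apply/rowP => i; have [j ->|->] := unliftP ord0 i.
  by rewrite [LHS]mxE !row_consS [RHS]mxE.
by rewrite [LHS]mxE !row_cons0.
Qed.

Lemma vol_opp n (A : set (space n)) : measurable A ->
  vol n ((fun x : 'rV[R]_n => - x) @^-1` A) = vol n A.
Proof.
elim: n A => [|n IH] A mA.
  by congr (vol 0 _); apply/funext => x; congr A; apply/rowP => -[].
rewrite !vol_slice -[RHS](@preserved_integral (fun t => - t) _ _
  (measurable_vol_slice mA) _ lebesgue_opp) //; last exact: measurableT_comp.
apply: eq_integral => t _; rewrite -[RHS]IH; last exact: measurable_slice.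
congr (vol n _); apply/funext => v; congr (A _).
apply/rowP => i; have [j ->|->] := unliftP ord0 i.
  by rewrite [LHS]mxE !row_consS [RHS]mxE.
by rewrite [LHS]mxE !row_cons0.
Qed.

Lemma measurable_addv d (T : measurableType d) n (f g : T -> space n) :
  measurable_fun setT f -> measurable_fun setT g ->
  measurable_fun setT (fun t => (f t : 'rV[R]_n) + g t : space n).
Proof.
move=> mf mg; apply: measurable_to_space => i.
under eq_fun do rewrite mxE.
apply: measurable_funD; first exact: (measurableT_comp (measurable_coord i) mf).
exact: (measurableT_comp (measurable_coord i) mg).
Qed.

Lemma measurable_oppv n :
  measurable_fun setT (fun x : space n => - (x : 'rV[R]_n) : space n).
Proof.
apply: measurable_to_space => i; under eq_fun do rewrite mxE.
by apply: measurableT_comp => //; exact: measurable_coord.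
Qed.

Lemma product_measure12 d1 d2 (T1 : measurableType d1) (T2 : measurableType d2)
    (m1 : {sigma_finite_measure set T1 -> \bar R})
    (m2 : {sigma_finite_measure set T2 -> \bar R}) (A : set (T1 * T2)) :
  measurable A -> ((m1 \x m2) A = (m1 \x^ m2) A)%E.
Proof.
apply: (product_measure_unique
  (m' := lebesgue_integral_fubini_product_measure2__canonical__measure_function_Measure m1 m2)).
by move=> B C mB mC; exact: product_measure2E.
Qed.

(** Both sides are the measure, for mu times the Lebesgue measure, of a subset
    of R^n x R^n: the set of (x, y) with x in A and x + y in B, respectively
    with x in B and x - y in A. The first one is carried to the second one by
    (x, y) |-> (x + y, y), which shifts x for fixed y and so preserves the
    product measure. Their slices at fixed x are translates of B and of -A. *)
Lemma shift_invariant_proportional n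
    (mu : {sigma_finite_measure set (space n) -> \bar R}) :
  (forall (a : 'rV[R]_n) (A : set (space n)), measurable A ->
    mu ((fun x : 'rV[R]_n => x + a) @^-1` A) = mu A) ->
  forall A B : set (space n), measurable A -> measurable B ->
  (mu A * vol n B = mu B * vol n A)%E.
Proof.
move=> mu_shift A B mA mB.
pose add (p : space n * space n) : space n := (p.1 : 'rV[R]_n) + p.2.
pose sub (p : space n * space n) : space n := (p.1 : 'rV[R]_n) - p.2.
have madd : measurable_fun setT add by exact: measurable_addv.
have msub : measurable_fun setT sub.
  apply: measurable_addv => //.
  exact: (measurableT_comp (@measurable_oppv n) measurable_snd).
have mpre d (T : measurableType d) (f : T -> space n) X :
    measurable_fun setT f -> measurable X -> measurable (f @^-1` X).
  by move=> mf mX; rewrite -[Y in measurable Y]setTI; exact: mf.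
pose E := (fst @^-1` A) `&` (add @^-1` B).
pose F := (fst @^-1` B) `&` (sub @^-1` A).
have mE : measurable E by apply: measurableI; exact: mpre.
have mF : measurable F by apply: measurableI; exact: mpre.
transitivity ((mu \x vol n)%E E).
  rewrite -product_measure1E//; apply: eq_integral => x _ /=.
  have [xA|xA] := pselect (A x).
    rewrite (_ : xsection (A `*` B) x = B); last first.
      by apply/seteqP; split=> y; rewrite /xsection /= inE //= => -[].
    rewrite -(vol_shift x mB); congr (vol n _).
    apply/seteqP; split=> y; rewrite /xsection /= inE /E /add /= addrC //.
    by case.
  congr (vol n _); apply/seteqP; split=> y; rewrite /xsection /= !inE.
    by case.
  by case.
transitivity ((mu \x vol n)%E F).
  rewrite !product_measure12//; apply: eq_integral => y _ /=.
  rewrite -(mu_shift y (ysection F y)); last exact: measurable_ysection.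
  congr (mu _); apply/seteqP; split=> x; rewrite /ysection /= !inE.
    by rewrite /F /sub /= addrK => -[].
  by rewrite /F /sub /= addrK => -[].
rewrite -product_measure1E//; apply: eq_integral => x _ /=.
have [xB|xB] := pselect (B x).
  rewrite (_ : xsection (B `*` A) x = A); last first.
    by apply/seteqP; split=> y; rewrite /xsection /= inE //= => -[].
  rewrite -(vol_shift x mA) -vol_opp; last first.
    apply: mpre => //; apply: measurable_addv => //; exact: measurable_cst.
  congr (vol n _); apply/seteqP; split=> y; rewrite /xsection /= inE /F /sub /= addrC //.
  by case.
congr (vol n _); apply/seteqP; split=> y; rewrite /xsection /= !inE.
  by case.
by case.
Qed.

End coordinate_space.

(** * Euclidean geometry of row vectors *)

Section euclid.
Context (R : realType) (n : nat).
Implicit Types x y z : 'rV[R]_n.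

Lemma dotpC x y : dotp x y = dotp y x.
Proof. by apply: eq_bigr => i _; rewrite mulrC. Qed.

Lemma dotpDl x y z : dotp (x + y) z = dotp x z + dotp y z.
Proof. by rewrite /dotp -big_split; apply: eq_bigr => i _; rewrite mxE mulrDl. Qed.

Lemma dotpZl a x y : dotp (a *: x) y = a * dotp x y.
Proof. by rewrite /dotp mulr_sumr; apply: eq_bigr => i _; rewrite mxE mulrA. Qed.

Lemma dotpNl x y : dotp (- x) y = - dotp x y.
Proof. by rewrite -scaleN1r dotpZl mulN1r. Qed.

Lemma dotpDr x y z : dotp x (y + z) = dotp x y + dotp x z.
Proof. by rewrite dotpC dotpDl !(dotpC x). Qed.

Lemma dotpZr a x y : dotp x (a *: y) = a * dotp x y.
Proof. by rewrite dotpC dotpZl dotpC. Qed.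

Lemma dotpNr x y : dotp x (- y) = - dotp x y.
Proof. by rewrite dotpC dotpNl dotpC. Qed.

Lemma dotp_ge0 x : 0 <= dotp x x.
Proof. by apply: sumr_ge0 => i _; exact: sqr_ge0. Qed.

Lemma enorm_ge0 x : 0 <= enorm x.
Proof. exact: sqrtr_ge0. Qed.

Lemma enorm_sqr x : enorm x ^+ 2 = dotp x x.
Proof. by rewrite sqr_sqrtr// dotp_ge0. Qed.

Lemma le_coord_enorm x i : `|x ord0 i| <= enorm x.
Proof.
rewrite -(@ler_pXn2r _ 2)// ?nnegrE ?enorm_ge0// enorm_sqr real_normK ?num_real//.
rewrite /dotp (bigD1 i)//= -expr2 lerDl.
by apply: sumr_ge0 => j _; exact: sqr_ge0.
Qed.

Lemma enorm0 : enorm (0 : 'rV[R]_n) = 0.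
Proof. by rewrite /enorm /dotp big1 ?sqrtr0// => i _; rewrite mxE mul0r. Qed.

Lemma enorm_eq0 x : (enorm x == 0) = (x == 0).
Proof.
apply/eqP/eqP => [x0|->]; last exact: enorm0.
apply/rowP => i; apply/eqP; rewrite mxE -normr_eq0 eq_le normr_ge0 andbT.
by rewrite -x0 le_coord_enorm.
Qed.

Lemma enorm_gt0 x : (0 < enorm x) = (x != 0).
Proof. by rewrite lt_neqAle enorm_ge0 andbT eq_sym enorm_eq0. Qed.

Lemma enormZ a x : enorm (a *: x) = `|a| * enorm x.
Proof.
rewrite /enorm dotpZl dotpZr mulrA -expr2 sqrtrM ?sqr_ge0//.
by rewrite sqrtr_sqr.
Qed.

Lemma enormN x : enorm (- x) = enorm x.
Proof. by rewrite /enorm dotpNl dotpNr opprK. Qed.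

Lemma enorm_distC x y : enorm (x - y) = enorm (y - x).
Proof. by rewrite -enormN opprB. Qed.

(** Cauchy-Schwarz, by expanding the square of |y|^2 x - <x, y> y. *)
Lemma dotp_le_enorm x y : dotp x y <= enorm x * enorm y.
Proof.
have [->|y0] := eqVneq y 0.
  by rewrite -(scale0r 0) dotpZr mul0r scale0r enorm0 mulr0.
have b0 : 0 < dotp y y by rewrite -enorm_sqr exprn_gt0// enorm_gt0.
have := dotp_ge0 (dotp y y *: x - dotp x y *: y).
rewrite !(dotpDl, dotpDr, dotpNl, dotpNr, dotpZl, dotpZr) (dotpC y x) => h.
have {}h : dotp x y ^+ 2 <= dotp x x * dotp y y.
  by rewrite -subr_ge0 -(pmulr_rge0 _ b0); apply: le_trans h _; lra.
apply: le_trans (ler_norm _) _.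
rewrite -(@ler_pXn2r _ 2)// ?nnegrE ?mulr_ge0 ?enorm_ge0//.
by rewrite exprMn !enorm_sqr real_normK ?num_real.
Qed.

Lemma enormD x y : enorm (x + y) <= enorm x + enorm y.
Proof.
rewrite -(@ler_pXn2r _ 2)// ?nnegrE ?addr_ge0 ?enorm_ge0//.
rewrite enorm_sqr sqrrD !enorm_sqr !(dotpDl, dotpDr) (dotpC y x).
have := dotp_le_enorm x y; lra.
Qed.

Lemma enorm_dist_trans z x y : enorm (x - y) <= enorm (x - z) + enorm (z - y).
Proof. by apply: le_trans (enormD _ _); rewrite addrA subrK. Qed.

Lemma enorm_dist x y : `|enorm x - enorm y| <= enorm (x - y).
Proof.
rewrite ler_norml; apply/andP; split.
  rewrite lerNl opprB lerBlDr enorm_distC.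
  by apply: le_trans (enormD _ _); rewrite subrK.
by rewrite lerBlDr; apply: le_trans (enormD _ _); rewrite subrK.
Qed.

Lemma enorm_le_sum x : enorm x <= \sum_(i < n) `|x ord0 i|.
Proof.
have h0 (A : pred 'I_n) : 0 <= \sum_(i < n | A i) `|x ord0 i| by exact: sumr_ge0.
rewrite -(@ler_pXn2r _ 2)// ?nnegrE ?enorm_ge0// enorm_sqr.
rewrite expr2 mulr_suml; apply: ler_sum => i _.
rewrite (le_trans (ler_norm _))// normrM ler_wpM2l//.
by rewrite (bigD1 i)//= lerDl.
Qed.

Lemma ball_le_enorm x y e : ball x e y -> enorm (x - y) <= n%:R * e.
Proof.
move=> [_ xy].
rewrite (le_trans (enorm_le_sum _))// -[n in n%:R](card_ord n) -sumr_const.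
rewrite mulr_suml; apply: ler_sum => i _; rewrite mul1r !mxE ltW//.
exact: xy.
Qed.

Lemma eball_ball x e : 0 < e -> eball x e `<=` ball x e.
Proof.
move=> e0 y xy; split=> // i j; rewrite (ord1 i) /ball /=.
have := le_coord_enorm (y - x) j; rewrite !mxE distrC => h.
exact: le_lt_trans h xy.
Qed.

Lemma nbhs_eball x e : 0 < e -> nbhs x (eball x e).
Proof.
move=> e0; apply/nbhs_ballP; exists (e / n.+1%:R); first by rewrite /= divr_gt0.
move=> y /ball_le_enorm; rewrite enorm_distC => h; rewrite /eball /=.
apply: le_lt_trans h _; rewrite mulrCA gtr_pMr// ltr_pdivrMr// mul1r.
by rewrite ltr_nat.
Qed.

Lemma nbhs_eballP x (U : set 'rV[R]_n) :
  nbhs x U <-> exists2 e, 0 < e & eball x e `<=` U.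
Proof.
split=> [/nbhs_ballP[e /= e0 eU]|[e e0 eU]].
  by exists e => //; exact: subset_trans (eball_ball e0) eU.
by apply: filterS eU _; exact: nbhs_eball.
Qed.

Lemma enorm_sub_continuous y : continuous (fun x => enorm (x - y)).
Proof.
move=> x U /nbhs_ballP[e /= e0 eU]; apply/nbhs_eballP; exists e => // z xz.
apply: eU; apply: le_lt_trans (enorm_dist _ _) _.
by rewrite opprB addrA subrK enorm_distC.
Qed.

Lemma open_eball x e : open (eball x e).
Proof.
rewrite (_ : eball x e = (fun y => enorm (y - x)) @^-1` [set t | t < e]) //.
apply: open_comp; last exact: open_lt.
by move=> y _; exact: enorm_sub_continuous.
Qed.

Lemma closed_sphere x e : closed [set y | enorm (y - x) = e].
Proof.
rewrite (_ : [set y | _] = (fun y => enorm (y - x)) @^-1` [set e]) //.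
apply: preimage_closed; first by move=> y _; exact: enorm_sub_continuous.
exact: closed_eq.
Qed.

Lemma closure_eballP A x :
  closure A x <-> forall e, 0 < e -> exists2 y, A y & enorm (y - x) < e.
Proof.
split=> [Ax e e0|Ax U /nbhs_eballP[e e0 eU]].
  by have [y [Ay xy]] := Ax _ (nbhs_eball x e0); exists y.
by have [y Ay xy] := Ax e e0; exists y; split=> //; exact: eU.
Qed.

Lemma closure_diam A d :
  (forall x y, A x -> A y -> enorm (x - y) <= d) ->
  forall x y, closure A x -> closure A y -> enorm (x - y) <= d.
Proof.
move=> Ad x y /closure_eballP Ax /closure_eballP Ay.
apply/ler_addgt0Pr => e e0; have e20 : 0 < e / 2 by rewrite divr_gt0.
have [x' Ax' xx'] := Ax _ e20; have [y' Ay' yy'] := Ay _ e20.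
have := Ad _ _ Ax' Ay'; have := enorm_dist_trans x' x y.
have := enorm_dist_trans y' x' y; rewrite (enorm_distC x x'); lra.
Qed.

(** An open set is a countable union of boxes with rational centres and
    sides 2 / (m + 1). *)
Lemma open_measurable_space (U : set 'rV[R]_n) :
  open U -> measurable (U : set (space R n)).
Proof.
move=> oU.
pose box (p : 'rV[rat]_n * nat) : set (space R n) := \bigcap_(i in [set: 'I_n])
  (fun x : 'rV[R]_n => x ord0 i) @^-1` (ball (ratr (p.1 ord0 i) : R) p.2.+1%:R^-1).
pose F p := if pselect (box p `<=` U) then box p else set0.
have mbox p : measurable (box p).
  have mI i : measurable ((fun x : 'rV[R]_n => x ord0 i) @^-1`
      ball (ratr (p.1 ord0 i) : R) p.2.+1%:R^-1 : set (space R n)).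
    rewrite -[X in measurable X]setTI; apply: measurable_coord => //.
    exact: measurable_ball.
  exact: (fin_bigcap_measurable (@finite_finset _ [set: 'I_n]) (fun i _ => mI i)).
have mF p : measurable (F p) by rewrite /F; case: pselect => h; [exact: mbox|exact: measurable0].
suff -> : U = \bigcup_p F p by apply: countable_bigcupT_measurable.
apply/seteqP; split=> [x Ux|x [p _]]; last first.
  by rewrite /F; case: pselect => [bU|//]; exact: bU.
have /nbhs_ballP[e /= e0 eU] : nbhs x U by exact: open_nbhs_nbhs.
have e20 : 0 < e / 2 by rewrite divr_gt0.
have [N _ /(_ N (leqnn N)) /= Ne] := near_infty_natSinv_lt (PosNum e20).
have [q qx] : {q : 'I_n -> rat & forall i, ball (x ord0 i) N.+1%:R^-1 (ratr (q i) : R)}.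
  apply: (@choice _ _ (fun i q => ball (x ord0 i) N.+1%:R^-1 (ratr q : R))) => i.
  have inv0 : 0 < N.+1%:R^-1 :> R by rewrite invr_gt0.
  have [] := @dense_rat R (ball (x ord0 i) N.+1%:R^-1).
  - by exists (x ord0 i); exact: ballxx.
  - exact: ball_open.
  by move=> y [xy [r _ ry]]; exists r; rewrite ry.
exists (\row_i q i, N) => //.
have bx : box (\row_i q i, N) x.
  by move=> i _ /=; rewrite mxE; apply: ball_sym; exact: qx.
rewrite /F; case: pselect => [//|]; case=> y by_; apply: eU; split=> // i j.
rewrite (ord1 i) [e]splitr; apply: ball_triangle (le_ball (ltW Ne) (qx j)) _.
by have := by_ j I; rewrite /= mxE; exact/le_ball/ltW.
Qed.

Lemma closed_measurable_space (F : set 'rV[R]_n) :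
  closed F -> measurable (F : set (space R n)).
Proof.
move=> cF; rewrite -[F]setCK; apply: measurableC.
by apply: open_measurable_space; rewrite openC.
Qed.

End euclid.

(** * Volumes of cubes and balls, invariance under reflections *)

Section volumes.
Context (R : realType).

Lemma measurable_scalev n a :
  measurable_fun setT (fun x : space R n => a *: (x : 'rV[R]_n) : space R n).
Proof.
apply: measurable_to_space => i; under eq_fun do rewrite mxE.
by apply: measurable_funM => //; exact: measurable_coord.
Qed.

Lemma measurable_space_preimage n (f : space R n -> space R n) A :
  measurable_fun setT f -> measurable A -> measurable (f @^-1` A).
Proof. by move=> mf mA; rewrite -[Y in measurable Y]setTI; exact: mf. Qed.

Definition cube n (c : R) : set 'rV[R]_n :=
  [set x | forall i, 0 <= x ord0 i <= c].
Arguments cube : clear implicits.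

Lemma slice_cube n c t :
  slice (cube n.+1 c : set (space R n.+1)) t =
  if (0 <= t <= c) then cube n c else set0.
Proof.
apply/seteqP; split=> v /=.
  move=> cv; have := cv ord0; rewrite row_cons0 => -> i.
  by have := cv (lift ord0 i); rewrite row_consS.
case: ifPn => // ct cv i; have [j ->|->] := unliftP ord0 i.
  by rewrite row_consS.
by rewrite row_cons0.
Qed.

Lemma measurable_cube n c : measurable (cube n c : set (space R n)).
Proof.
rewrite (_ : cube n c = \bigcap_(i in [set: 'I_n])
  (fun x : 'rV[R]_n => x ord0 i) @^-1` `[0, c]%classic); last first.
  apply/seteqP; split=> x cx i; first by move=> _; rewrite /= in_itv /=; exact: cx.
  by have := cx i I; rewrite /= in_itv.
have mI i : measurable ((fun x : 'rV[R]_n => x ord0 i) @^-1` `[0, c]%classic :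
    set (space R n)).
  by rewrite -[X in measurable X]setTI; apply: measurable_coord.
exact: (fin_bigcap_measurable (@finite_finset _ [set: 'I_n]) (fun i _ => mI i)).
Qed.

Lemma vol_cube n c : 0 <= c -> vol R n (cube n c) = (c ^+ n)%:E.
Proof.
move=> c0; elim: n => [|n IH].
  by rewrite volE /= expr0 mem_set//; case.
rewrite vol_slice.
under eq_integral.
  move=> t _; rewrite slice_cube.
  rewrite (_ : vol R n _ = (c ^+ n * \1_(`[0, c]%classic) t)%:E); last first.
    rewrite indicE; case: ifPn => ct.
      by rewrite mem_set ?mulr1 //= in_itv.
    by rewrite measure0 memNset ?mulr0//= in_itv/=; exact/negP.
  rewrite EFinM; over.
rewrite ge0_integralZl//; last 2 first.
  - exact/measurable_EFinP.
  - by rewrite lee_fin exprn_ge0.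
rewrite integral_indic// setIT [X in (_ * X)%E](lebesgue_measure_itv `[0, c]).
rewrite /= lte_fin.
case: ltP => [_|c0']; first by rewrite -EFinB subr0 -EFinM exprSr.
have -> : c = 0 by apply/le_anti/andP.
by rewrite mule0 expr0n.
Qed.

(** A dilated Lebesgue measure is translation invariant, so it is a multiple of
    the Lebesgue measure; the unit cube gives the factor. *)
Lemma vol_scale n c (A : set (space R n)) : 0 < c -> measurable A ->
  vol R n ((fun x : 'rV[R]_n => c^-1 *: x) @^-1` A) = ((c ^+ n)%:E * vol R n A)%E.
Proof.
move=> c0 mA; have cN0 : c != 0 by rewrite gt_eqF.
have [M ME] := pushforward_sigma_finite (vol R n) (@measurable_scalev n c^-1)
  (@measurable_scalev n c) (fun x => scalerKV cN0 x).
(* a shift by a after scaling by 1 / c is a shift by c a before it *)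
have Mshift (a : 'rV[R]_n) (B : set (space R n)) : measurable B ->
    M ((fun x : 'rV[R]_n => x + a) @^-1` B) = M B.
  move=> mB; rewrite ME /pushforward -[RHS](vol_shift (c *: a)); last first.
    exact: (measurable_space_preimage (@measurable_scalev n c^-1) mB).
  congr (vol R n _); apply/funext => x.
  by rewrite /preimage /mkset scalerDr scalerK.
have := shift_invariant_proportional Mshift mA (@measurable_cube n 1).
rewrite vol_cube// expr1n mule1 ME /pushforward => h; apply: (etrans h).
rewrite -vol_cube ?ltW//; congr (vol R n _ * _)%E.
apply/seteqP; split=> x /= cx i; have := cx i; rewrite !mxE.
  by rewrite pmulr_rge0 ?invr_gt0// mulrC ler_pdivrMr// mul1r.
by rewrite pmulr_rge0 ?invr_gt0// mulrC ler_pdivrMr// mul1r.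
Qed.

Lemma measurable_eball n (x : 'rV[R]_n) e : measurable (eball x e : set (space R n)).
Proof. by apply: open_measurable_space; exact: open_eball. Qed.

(** The ball contains a small cube and is contained in a translated cube of
    side 2, so that its volume is finite and [fine] loses nothing in [omega]. *)
Lemma vol_unit_ball n :
  vol R n (eball (0 : 'rV[R]_n) 1) = (omega R n)%:E /\ 0 < omega R n.
Proof.
rewrite /omega -(volE (eball (0 : 'rV[R]_n) 1)); set b := vol R n _.
have b0 : (0 < b)%E.
  apply: (@lt_le_trans _ _ (vol R n (cube n n.+1%:R^-1))).
    by rewrite vol_cube// lte_fin exprn_gt0.
  apply: le_measure; rewrite ?inE.
  - exact: measurable_cube.
  - exact: measurable_eball.
  move=> x cx; rewrite /eball /= subr0 (le_lt_trans (enorm_le_sum x))//.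
  apply: (@le_lt_trans _ _ (n%:R * n.+1%:R^-1)).
    rewrite -[n in n%:R](card_ord n) -sumr_const.
    rewrite mulr_suml; apply: ler_sum => i _; rewrite mul1r.
    by have /andP[x0 x1] := cx i; rewrite ger0_norm.
  by rewrite ltr_pdivrMr// mul1r ltr_nat.
have boo : (b < +oo)%E.
  pose one : 'rV[R]_n := const_mx 1.
  apply: (@le_lt_trans _ _ (vol R n (cube n 2))); last by rewrite vol_cube// ltry.
  rewrite -(vol_shift one (@measurable_cube n 2)).
  apply: le_measure; rewrite ?inE.
  - exact: measurable_eball.
  - apply: measurable_space_preimage; last exact: measurable_cube.
    by apply: measurable_addv => //; exact: measurable_cst.
  move=> x; rewrite /eball /= subr0 => x1 i; rewrite !mxE.
  by have := le_lt_trans (le_coord_enorm x i) x1; rewrite ltr_norml => /andP[]; lra.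
have bfin : b \is a fin_num by rewrite ge0_fin_numE// ltW.
by split; [rewrite fineK|rewrite fine_gt0// b0].
Qed.

Lemma omega_gt0 n : 0 < omega R n.
Proof. by have [] := vol_unit_ball n. Qed.

Lemma vol_ball n r : 0 < r ->
  vol R n (eball (0 : 'rV[R]_n) r) = (r ^+ n * omega R n)%:E.
Proof.
move=> r0; rewrite EFinM -(vol_unit_ball n).1 -vol_scale//; last exact: measurable_eball.
congr (vol R n _); apply/seteqP; split=> x; rewrite /eball /= !subr0 enormZ.
  by rewrite gtr0_norm ?invr_gt0// mulrC ltr_pdivrMr// mul1r.
by rewrite gtr0_norm ?invr_gt0// mulrC ltr_pdivrMr// mul1r.
Qed.

Section reflection.
Context (n : nat) (w : 'rV[R]_n).

(** The reflection in the hyperplane orthogonal to w; it is the identity when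
    w = 0 because division by 0 gives 0. *)
Definition reflection (x : 'rV[R]_n) : 'rV[R]_n :=
  x - (2 * dotp x w / dotp w w) *: w.

Lemma reflectionD x y : reflection (x + y) = reflection x + reflection y.
Proof.
rewrite /reflection dotpDl mulrDr mulrDl scalerDl opprD !addrA.
by congr (_ - _); rewrite -!addrA; congr (_ + _); rewrite addrC.
Qed.

Lemma reflectionZ a x : reflection (a *: x) = a *: reflection x.
Proof.
by rewrite /reflection scalerBr scalerA dotpZl; congr (_ - _ *: _); ring.
Qed.

Lemma reflectionB x y : reflection (x - y) = reflection x - reflection y.
Proof. by rewrite -scaleN1r reflectionD reflectionZ scaleN1r. Qed.

Lemma reflectionK : involutive reflection.
Proof.
move=> x; rewrite /reflection; have [->|w0] := eqVneq w 0; first by rewrite !scaler0 !subr0.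
have d0 : dotp w w != 0 by rewrite -enorm_sqr expf_neq0// enorm_eq0.
have -> : dotp (x - (2 * dotp x w / dotp w w) *: w) w = - dotp x w.
  by rewrite dotpDl dotpNl dotpZl; field.
by rewrite mulrN mulNr scaleNr opprK subrK.
Qed.

Lemma enorm_reflection x : enorm (reflection x) = enorm x.
Proof.
rewrite /reflection; have [->|w0] := eqVneq w 0; first by rewrite !scaler0 !subr0.
have d0 : dotp w w != 0 by rewrite -enorm_sqr expf_neq0// enorm_eq0.
rewrite /enorm; congr Num.sqrt.
rewrite !(dotpDl, dotpDr, dotpNl, dotpNr, dotpZl, dotpZr) (dotpC w x).
by field.
Qed.

Lemma measurable_reflection :
  measurable_fun setT (reflection : space R n -> space R n).
Proof.
apply: measurable_to_space => i.
rewrite (_ : (fun t => _) = fun x : space R n => (x : 'rV[R]_n) ord0 i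
   + - (2 / dotp w w * w ord0 i) * \sum_(j < n) (x : 'rV[R]_n) ord0 j * w ord0 j).
  apply: measurable_funD; first exact: measurable_coord.
  apply: measurable_funM => //; apply: measurable_sum => j.
  by apply: measurable_funM => //; exact: measurable_coord.
apply/funext => x; rewrite !mxE -/(dotp _ w); ring.
Qed.

(** The image measure is translation invariant, hence a multiple of the
    Lebesgue measure; the unit ball, which is preserved, gives factor 1. *)
Lemma vol_reflection (A : set (space R n)) : measurable A ->
  vol R n (reflection @^-1` A) = vol R n A.
Proof.
move=> mA.
have [M ME] := pushforward_sigma_finite (vol R n) measurable_reflection
  measurable_reflection reflectionK.
have [bE b0] := vol_unit_ball n.
have Mshift (a : 'rV[R]_n) (B : set (space R n)) : measurable B ->
    M ((fun x : 'rV[R]_n => x + a) @^-1` B) = M B.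
  move=> mB; rewrite ME /pushforward -[RHS](vol_shift (reflection a)); last first.
    exact: (measurable_space_preimage measurable_reflection mB).
  congr (vol R n _); apply/funext => x.
  by rewrite /preimage /mkset reflectionD reflectionK.
have := shift_invariant_proportional Mshift mA (measurable_eball 0 1).
rewrite ME /pushforward (_ : reflection @^-1` eball 0 1 = eball 0 1); last first.
  by apply/seteqP; split=> x; rewrite /eball /= !subr0 enorm_reflection.
have bN0 : omega R n != 0 by rewrite gt_eqF.
rewrite bE muleC => /eqP; rewrite -eqe_pdivrMl// muleA -EFinM.
by rewrite mulVf// mul1e => /eqP.
Qed.

End reflection.

Lemma reflection_to n (p q : 'rV[R]_n) : enorm p = enorm q ->
  reflection (p - q) p = q.
Proof.
move=> pq; rewrite /reflection.
have [->|w0] := eqVneq p q; first by rewrite subrr scaler0 subr0.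
have d0 : dotp (p - q) (p - q) != 0 by rewrite -enorm_sqr expf_neq0// enorm_eq0 subr_eq0.
suff -> : 2 * dotp p (p - q) / dotp (p - q) (p - q) = 1.
  by rewrite scale1r subKr.
apply: (canLR (mulfK d0)); rewrite mul1r.
have : dotp p p = dotp q q by rewrite -!enorm_sqr pq.
rewrite !(dotpDl, dotpDr, dotpNl, dotpNr, dotpZl, dotpZr) (dotpC q p); lra.
Qed.

End volumes.

(** * The one-dimensional Prekopa-Leindler inequality *)

Lemma le_at_right_limit (R : realType) (g : R -> R) d d' v : d < d' ->
  {for d, continuous g} -> (forall rho, d < rho < d' -> v <= g rho) -> v <= g d.
Proof.
move=> dd' gd vg; rewrite leNgt; apply/negP => gv.
have /nbhs_ballP[e /= e0 eg] : \forall t \near d, g t < v by exact: cvgr_lt gd _ gv.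
pose h := Num.min e (d' - d) / 2.
have m0 : 0 < Num.min e (d' - d) by rewrite lt_min e0 subr_gt0.
have h0 : 0 < h by rewrite divr_gt0.
have hm : h < Num.min e (d' - d) by rewrite ltr_pdivrMr// ltr_pMr// ltr1n.
have /andP[he hd] : (h < e) && (h < d' - d) by rewrite -lt_min.
have := vg (d + h); rewrite ltrDl h0 -ltrBrDl hd => /(_ isT); apply/negP.
rewrite -ltNge; apply: eg; rewrite /ball /= opprD addrA subrr sub0r normrN.
by rewrite gtr0_norm.
Qed.

Section line.
Context (R : realType).
Notation line := (measurableTypeR R).
Notation mu := (@lebesgue_measure R).

(** If A has a largest element a and B a smallest element b, then C contains
    A + b and a + B, which meet in at most one point. In general, cut A above
    a point a close to its supremum and B below a point b close to its
    infimum. *)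
Lemma lebesgue_sum_le (A B C : set line) M :
  measurable A -> measurable B -> measurable C -> A !=set0 -> B !=set0 ->
  A `<=` `[(- M), M] -> B `<=` `[(- M), M] ->
  (forall s t, A s -> B t -> C (s + t)) -> (mu A + mu B <= mu C)%E.
Proof.
move=> mA mB mC A0 B0 AM BM ABC.
(* translate the two truncations to the two sides of the point a + b *)
have trunc a b : A a -> B b ->
    (mu (A `&` `]-oo, a]) + mu (B `&` `]b, +oo[) <= mu C)%E.
  move=> Aa Bb.
  have mA' : measurable (A `&` `]-oo, a]) by apply: measurableI => //; exact: measurable_itv.
  have mB' : measurable (B `&` `]b, +oo[) by apply: measurableI => //; exact: measurable_itv.
  rewrite -(lebesgue_shift (- b) mA') -(lebesgue_shift (- a) mB').
  have mpre c (X : set line) : measurable X -> measurable ((fun t => t + c) @^-1` X).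
    by move=> mX; rewrite -[Y in measurable Y]setTI; exact: measurable_shift.
  rewrite -measureU; [|exact: mpre|exact: mpre|].
  - apply: le_measure; rewrite ?inE//; first by apply: measurableU; exact: mpre.
    move=> t [[At _]|[Bt _]]; first by rewrite -(subrK b t); exact: ABC.
    by rewrite -(subrK a t) addrC; exact: ABC.
  - apply/seteqP; split=> // t [[_ /=]]; rewrite in_itv /= => h1 [_].
    by rewrite /= in_itv /= andbT ltrBrDr addrC -ltrBrDr ltNge h1.
have supA : has_sup A.
  by split=> //; exists M => y /AM; rewrite /= in_itv => /andP[].
have infB : has_inf B.
  by split=> //; exists (- M) => y /BM; rewrite /= in_itv => /andP[].
apply/lee_addgt0Pr => e e0; have e20 : 0 < e / 2 by rewrite divr_gt0.
have [a Aa ae] := sup_adherent e20 supA.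
have [b Bb be] := inf_adherent e20 infB.
have muA : (mu A <= mu (A `&` `]-oo, a]) + (e / 2)%:E)%E.
  apply: (@le_trans _ _ (mu ((A `&` `]-oo, a]) `|` `]a, sup A]))).
    apply: le_measure; rewrite ?inE//.
      by apply: measurableU => //; exact: measurableI.
    move=> t At; have [ta|ta] := leP t a; [left|right].
      by split=> //=; rewrite in_itv.
    by rewrite /= in_itv /= ta; apply: ub_le_sup => //; case: supA.
  rewrite (le_trans (measureU2 _ _ _))//; first exact: measurableI.
  rewrite leeD2l// [leLHS](lebesgue_measure_itv `]a, sup A]) /= lte_fin; case: ifP => _.
    by rewrite -EFinB lee_fin; lra.
  by rewrite lee_fin ltW.
have muB : (mu B <= mu (B `&` `]b, +oo[) + (e / 2)%:E)%E.
  apply: (@le_trans _ _ (mu ((B `&` `]b, +oo[) `|` `[inf B, b]))).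
    apply: le_measure; rewrite ?inE//.
      by apply: measurableU => //; exact: measurableI.
    move=> t Bt; have [tb|tb] := ltP b t; [left|right].
      by split=> //=; rewrite in_itv /= tb.
    by rewrite /= in_itv /= tb andbT; apply: ge_inf => //; case: infB.
  rewrite (le_trans (measureU2 _ _ _))//; first exact: measurableI.
  rewrite leeD2l// [leLHS](lebesgue_measure_itv `[inf B, b]) /= lte_fin; case: ifP => _.
    by rewrite -EFinB lee_fin; lra.
  by rewrite lee_fin ltW.
apply: (le_trans (leeD muA muB)); rewrite addeACA -EFinD -splitr leeD2r//.
exact: trunc.
Qed.

(** The levels u * a with u < 0 are excluded so that an integral over all u is
    the integral over u >= 0. *)
Definition superlevel (f : line -> R) a (u : R) : set line :=
  [set t | 0 <= u /\ u * a < f t].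

(** Fubini for the region under the graph of f / a. *)
Lemma layer_cake (f : line -> R) a : measurable_fun setT f ->
  (forall t, 0 <= f t) -> 0 < a ->
  (\int[mu]_t (f t / a)%:E = \int[mu]_u mu (superlevel f a u))%E /\
  measurable_fun setT (mu \o superlevel f a : line -> \bar R).
Proof.
move=> mf f0 a0.
pose E : set (line * line) := [set p | 0 <= p.2 /\ p.2 * a < f p.1].
have mE : measurable E.
  rewrite (_ : E = (snd @^-1` `[0, +oo[) `&`
      ((fun p : line * line => f p.1 - p.2 * a) @^-1` `]0, +oo[)); last first.
    by apply/seteqP; split=> p /=; rewrite !in_itv /= !andbT subr_gt0.
  apply: measurableI; rewrite -[Y in measurable Y]setTI.
    exact: measurable_snd.
  suff mg : measurable_fun setT (fun p : line * line => f p.1 - p.2 * a) by exact: mg.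
  apply: measurable_funB; first exact: (measurableT_comp mf).
  exact: measurable_funM.
have yE u : ysection E u = superlevel f a u.
  by apply/seteqP; split=> t; rewrite /ysection /= inE.
split; last first.
  rewrite (_ : mu \o _ = mu \o ysection E); first exact: measurable_fun_ysection.
  by apply/funext => u /=; rewrite yE.
transitivity ((mu \x mu)%E E); last first.
  rewrite product_measure12//; apply: eq_integral => u _.
  by rewrite /= yE.
apply: eq_integral => t _ /=.
rewrite (_ : xsection E t = `[0, f t / a[%classic).
  rewrite [RHS](lebesgue_measure_itv `[0, f t / a[) /= lte_fin; case: ltP => h.
    by rewrite sube0.
  by congr EFin; apply/le_anti; rewrite h divr_ge0// ltW.
apply/seteqP; split=> u; rewrite /xsection /= inE /E /= in_itv /= ltr_pdivlMr//.
  by move=> [-> ->].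
by move=> /andP.
Qed.

(** Rescale the levels of f, g, h by a = sup f, b = sup g and d = sqrt (c a b).
    At each level u in [0, 1[ the level sets of f and g are nonempty and their
    sum lies in the level set of h, so their lengths add up to at most the
    length of the latter. Integrating over u gives
    If / a + Ig / b <= Ih / d, and the arithmetic-geometric inequality
    concludes. *)
Lemma prekopa_leindler (f g h : line -> R) c M N If Ig Ih :
  0 < c -> measurable_fun setT f -> measurable_fun setT g ->
  measurable_fun setT h ->
  (forall t, 0 <= f t <= N) -> (forall t, 0 <= g t <= N) -> (forall t, 0 <= h t) ->
  (forall t, 0 < f t -> `[(- M), M]%classic t) ->
  (forall t, 0 < g t -> `[(- M), M]%classic t) ->
  (forall s t, c * (f s * g t) <= h (s + t) ^+ 2) ->
  (\int[mu]_t (f t)%:E = If%:E)%E -> (\int[mu]_t (g t)%:E = Ig%:E)%E ->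
  (\int[mu]_t (h t)%:E = Ih%:E)%E ->
  4 * c * (If * Ig) <= Ih ^+ 2.
Proof.
move=> c0 mf mg mh fN gN h0 fM gM fgh fI gI hI.
have f0 t : 0 <= f t by have /andP[] := fN t.
have g0 t : 0 <= g t by have /andP[] := gN t.
have sup_range (k : line -> R) : (forall t, 0 <= k t <= N) -> has_sup (range k).
  move=> kN; split; first by exists (k 0); exists 0.
  by exists N => _ [t _ <-]; have /andP[] := kN t.
have le_sup (k : line -> R) t : (forall t, 0 <= k t <= N) -> k t <= sup (range k).
  by move=> kN; apply: ub_le_sup; [have [] := sup_range k kN|exists t].
pose a := sup (range f); pose b := sup (range g).
have null (k : line -> R) I : (forall t, 0 <= k t <= N) -> sup (range k) <= 0 ->
    (\int[mu]_t (k t)%:E = I%:E)%E -> I = 0.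
  move=> kN k0 kI; apply: EFin_inj; rewrite -kI integral0_eq// => t _.
  congr EFin; apply/le_anti; have /andP[-> _] := kN t.
  by rewrite (le_trans (le_sup k t kN) k0).
have [a0|a0] := leP a 0.
  by rewrite (null f If)// mul0r mulr0 sqr_ge0.
have [b0|b0] := leP b 0.
  by rewrite (null g Ig)// mulr0 mulr0 sqr_ge0.
pose d := Num.sqrt (c * (a * b)).
have d0 : 0 < d by rewrite sqrtr_gt0 !mulr_gt0.
have d2 : d ^+ 2 = c * (a * b) by rewrite sqr_sqrtr// ltW// !mulr_gt0.
have mlev (k : line -> R) e u : measurable_fun setT k -> measurable (superlevel k e u).
  move=> mk; have [u0|u0] := leP 0 u.
    rewrite (_ : superlevel k e u = k @^-1` `]u * e, +oo[).
      by rewrite -[Y in measurable Y]setTI; exact: mk.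
    by apply/seteqP; split=> t; rewrite /superlevel /= in_itv /= andbT u0 => // -[].
  rewrite (_ : superlevel k e u = set0) //.
  by apply/seteqP; split=> t // [] /le_lt_trans /(_ u0); rewrite ltxx.
have lev u : (mu (superlevel f a u) + mu (superlevel g b u) <= mu (superlevel h d u))%E.
  have [u1|u1] := leP 1 u.
    have empty k e : (forall t, k t <= e) -> 0 < e -> superlevel k e u = set0.
      move=> ke e0; apply/seteqP; split=> t // [_]; rewrite ltNge.
      by rewrite (le_trans (ke t))// ler_peMl// ltW.
    rewrite (empty f a)//; last by move=> t; exact: le_sup.
    rewrite (empty g b)//; last by move=> t; exact: le_sup.
    by rewrite measure0 adde0.
  have [u0|u0] := ltP u 0.
    have empty k e : superlevel k e u = set0.
      by apply/seteqP; split=> t // [] /le_lt_trans /(_ u0); rewrite ltxx.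
    by rewrite !empty !measure0 adde0.
  have nonempty (k : line -> R) : (forall t, 0 <= k t <= N) -> 0 < sup (range k) ->
      superlevel k (sup (range k)) u !=set0.
    move=> kN k0.
    have e0 : 0 < (1 - u) * sup (range k) by rewrite mulr_gt0// subr_gt0.
    have [_ [t _ <-] kt] := sup_adherent e0 (sup_range k kN).
    by exists t; split=> //; move: kt; rewrite mulrBl mul1r subKr.
  apply: (@lebesgue_sum_le _ _ _ M); try exact: mlev.
  - exact: nonempty.
  - exact: nonempty.
  - by move=> t [_] /(le_lt_trans _) ft; apply: fM; apply: ft; rewrite mulr_ge0// ltW.
  - by move=> t [_] /(le_lt_trans _) ft; apply: gM; apply: ft; rewrite mulr_ge0// ltW.
  - move=> s t [_ fs] [_ gt]; split=> //.
    rewrite -(@ltr_pXn2r _ 2)// ?nnegrE ?mulr_ge0// ?(ltW d0)//.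
    apply: lt_le_trans (fgh s t); rewrite exprMn d2.
    rewrite [ltLHS](_ : _ = c * ((u * a) * (u * b))); last by ring.
    rewrite ltr_pM2l// ltr_pM// mulr_ge0// ltW//.
have [cf mcf] := layer_cake mf f0 a0.
have [cg mcg] := layer_cake mg g0 b0.
have [ch mch] := layer_cake mh h0 d0.
have scale (k : line -> R) (e I : R) :
    measurable_fun setT k -> (forall t, 0 <= k t) -> 0 < e ->
    (\int[mu]_t (k t)%:E = I%:E)%E -> (\int[mu]_t (k t / e)%:E = (I / e)%:E)%E.
  move=> mk k0 e0 kI; under eq_integral do rewrite mulrC EFinM.
  rewrite ge0_integralZl//; last 3 first.
  - exact/measurable_EFinP.
  - by move=> t _; rewrite lee_fin.
  - by rewrite lee_fin invr_ge0 ltW.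
  by rewrite kI -EFinM mulrC.
have sum : If / a + Ig / b <= Ih / d.
  rewrite -lee_fin EFinD -(scale f a)// -(scale g b)// -(scale h d)//.
  rewrite cf cg ch -ge0_integralD//.
  apply: ge0_le_integral => //; last exact: (emeasurable_funD mcf mcg).
  by move=> u _; exact: adde_ge0.
have If0 : 0 <= If by rewrite -lee_fin -fI integral_ge0// => t _; rewrite lee_fin.
have Ig0 : 0 <= Ig by rewrite -lee_fin -gI integral_ge0// => t _; rewrite lee_fin.
have Ih0 : 0 <= Ih by rewrite -lee_fin -hI integral_ge0// => t _; rewrite lee_fin.
have x0 : 0 <= If / a by rewrite divr_ge0// ltW.
have y0 : 0 <= Ig / b by rewrite divr_ge0// ltW.
rewrite (_ : Ih = d * (Ih / d)); last by rewrite mulrC divfK// gt_eqF.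
rewrite exprMn d2 (_ : If * Ig = (a * b) * ((If / a) * (Ig / b))); last first.
  by field; rewrite !gt_eqF.
rewrite (_ : 4 * c * _ = c * (a * b) * (4 * ((If / a) * (Ig / b)))); last by ring.
rewrite ler_pM2l ?mulr_gt0//.
apply: (@le_trans _ _ ((If / a + Ig / b) ^+ 2)).
  rewrite -subr_ge0 (_ : _ - _ = (If / a - Ig / b) ^+ 2); last by ring.
  exact: sqr_ge0.
by rewrite ler_pXn2r// ?nnegrE ?addr_ge0// divr_ge0// ltW.
Qed.

End line.

(** * Brunn-Minkowski and isodiametric inequalities *)

Section isodiametric.
Context (R : realType).

Definition box n (M : R) : set 'rV[R]_n := [set x | forall i, `|x ord0 i| <= M].
Arguments box : clear implicits.

Lemma vol_box_le n M (A : set (space R n)) : 0 <= M -> measurable A ->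
  A `<=` box n M -> (vol R n A <= ((2 * M) ^+ n)%:E)%E.
Proof.
move=> M0 mA AM; pose s : 'rV[R]_n := const_mx M.
rewrite -vol_cube ?mulr_ge0// -(vol_shift s (@measurable_cube R n (2 * M))).
apply: le_measure; rewrite ?inE//.
  apply: measurable_space_preimage; last exact: measurable_cube.
  by apply: measurable_addv => //; exact: measurable_cst.
by move=> x /AM xM i; rewrite !mxE; have := xM i; rewrite ler_norml => /andP[]; lra.
Qed.

Lemma vol_fineK n M (A : set (space R n)) : 0 <= M -> measurable A ->
  A `<=` box n M -> (fine (vol R n A))%:E = vol R n A.
Proof.
move=> M0 mA AM; rewrite fineK// ge0_fin_numE//.
by apply: le_lt_trans (vol_box_le M0 mA AM) _; rewrite ltry.
Qed.

(** The volumes of the slices of A, B and C at heights s, t and s + t satisfy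
    the inequality in dimension n; this is the hypothesis of
    Prekopa-Leindler, whose conclusion multiplies the constant by 4. *)
Lemma brunn_minkowski n M (A B C : set (space R n)) : 0 <= M ->
  measurable A -> measurable B -> measurable C ->
  A `<=` box n M -> B `<=` box n M -> C `<=` box n M ->
  (forall x y : 'rV[R]_n, A x -> B y -> C (x + y)) ->
  4 ^+ n * (fine (vol R n A) * fine (vol R n B)) <= fine (vol R n C) ^+ 2.
Proof.
move=> M0; elim: n A B C => [|n IH] A B C mA mB mC AM BM CM ABC.
  rewrite !volE /= expr0 mul1r.
  have [A0|A0] := pselect (A 0); last by rewrite (memNset A0) mul0r sqr_ge0.
  have [B0|B0] := pselect (B 0); last by rewrite (memNset B0) mulr0 sqr_ge0.
  have C0 : C 0 by rewrite -[0]addr0; exact: ABC.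
  by rewrite !mem_set// mulr1 expr1n.
have sliceM (X : set (space R n.+1)) t : X `<=` box n.+1 M -> slice X t `<=` box n M.
  by move=> XM v /XM Xv i; have := Xv (lift ord0 i); rewrite row_consS.
pose f (X : set (space R n.+1)) (t : measurableTypeR R) := fine (vol R n (slice X t)).
have fK (X : set (space R n.+1)) t : measurable X -> X `<=` box n.+1 M ->
    (f X t)%:E = vol R n (slice X t).
  move=> mX XM; apply: (vol_fineK M0); first exact: measurable_slice.
  exact: sliceM.
have mf (X : set (space R n.+1)) : measurable X -> measurable_fun setT (f X).
  move=> mX; have := measurable_vol_slice mX.
  exact: (measurableT_comp (@fine_measurable R setT measurableT)).
have f0 X t : 0 <= f X t by exact: fine_ge0.
have fN (X : set (space R n.+1)) t : measurable X -> X `<=` box n.+1 M ->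
    0 <= f X t <= (2 * M) ^+ n.
  move=> mX XM; rewrite f0 -lee_fin fK// vol_box_le//; first exact: measurable_slice.
  exact: sliceM.
have fM (X : set (space R n.+1)) t : X `<=` box n.+1 M -> 0 < f X t ->
    `[(- M), M]%classic t.
  move=> XM fX; have [v Xv] : slice X t !=set0.
    by apply/set0P/eqP => X0; move: fX; rewrite /f X0 measure0 ltxx.
  by have := XM _ Xv ord0; rewrite row_cons0 ler_norml /= in_itv.
have fI (X : set (space R n.+1)) : measurable X -> X `<=` box n.+1 M ->
    (\int[lebesgue_measure]_t (f X t)%:E = (fine (vol R n.+1 X))%:E)%E.
  move=> mX XM; rewrite (vol_fineK M0)// vol_slice.
  by apply: eq_integral => t _; rewrite fK.
rewrite exprS; apply: (@prekopa_leindler R (f A) (f B) (f C) (4 ^+ n) M ((2 * M) ^+ n)).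
all: try by [|exact: mf|exact: fI|move=> t; exact: fN|move=> t; exact: fM].
move=> s t; apply: IH; try exact: measurable_slice; try exact: sliceM.
move=> x y Ax By; rewrite /slice /= (_ : row_cons _ =
  (row_cons (s, x) : 'rV_n.+1) + row_cons (t, y)); first exact: ABC.
apply/rowP => i; rewrite [RHS]mxE; have [j ->|->] := unliftP ord0 i.
  by rewrite !row_consS mxE.
by rewrite !row_cons0.
Qed.

(** For rho > d, Brunn-Minkowski for K and -K in the ball of radius rho reads
    2^n vol K <= rho^n omega_n. *)
Lemma isodiametric n d (K : set (space R n)) : 0 <= d -> measurable K ->
  (forall x y : 'rV[R]_n, K x -> K y -> enorm (x - y) <= d) ->
  (vol R n K <= (omega R n * (d / 2) ^+ n)%:E)%E.
Proof.
move=> d0 mK Kd; have w0 := omega_gt0 R n.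
have [->|/set0P[p Kp]] := eqVneq K set0.
  by rewrite measure0 lee_fin mulr_ge0 ?(ltW w0)// exprn_ge0// divr_ge0.
have KM : K `<=` box n (enorm (p : 'rV[R]_n) + d).
  move=> x Kx i; apply: le_trans (le_coord_enorm x i) _.
  have := enormD (p : 'rV[R]_n) (x - p : 'rV[R]_n); rewrite addrC subrK.
  by move/le_trans; apply; rewrite lerD2l; exact: Kd.
have M00 : 0 <= enorm (p : 'rV[R]_n) + d by rewrite addr_ge0 ?enorm_ge0.
have kK := vol_fineK M00 mK KM; rewrite -kK lee_fin.
set v := fine _ in kK *.
apply: (@le_at_right_limit R (fun rho => omega R n * (rho / 2) ^+ n) d (d + 1)).
- by rewrite ltrDl.
- apply: cvgM; first exact: cvg_cst.
  apply: (@cvg_comp _ _ _ (fun t => t / 2) (fun t => t ^+ n) _ (nbhs (d / 2))).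
    by apply: cvgM; [exact: cvg_id|exact: cvg_cst].
  exact: exprn_continuous.
move=> rho /andP[drho _]; have rho0 : 0 < rho by exact: le_lt_trans drho.
pose N := enorm (p : 'rV[R]_n) + d + rho.
have N0 : 0 <= N by rewrite addr_ge0// ltW.
pose K' : set (space R n) := (fun x : 'rV[R]_n => - x) @^-1` K.
have mK' : measurable K' by apply: measurable_space_preimage => //; exact: measurable_oppv.
have boxN M (X : set 'rV[R]_n) : M <= N -> X `<=` box n M -> X `<=` box n N.
  by move=> MN XM x /XM xM i; exact: le_trans (xM i) MN.
have := @brunn_minkowski n N K K' (eball (0 : 'rV[R]_n) rho) N0 mK mK'
  (measurable_eball 0 rho).
rewrite vol_opp// vol_ball//= -/v -expr2 => h.
have v0 : 0 <= v by exact: fine_ge0.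
have : (2 ^+ n * v) ^+ 2 <= (rho ^+ n * omega R n) ^+ 2.
  rewrite exprMn -exprM mulnC exprM (_ : 2 ^+ 2 = 4); last by ring.
  apply: h.
  - by apply: boxN KM; rewrite lerDl ltW.
  - move=> x /KM xM i; have := xM i; rewrite mxE normrN => /le_trans; apply.
    by rewrite lerDl ltW.
  - move=> x; rewrite /eball /= subr0 => xr i.
    apply: le_trans (le_coord_enorm x i) _; apply: le_trans (ltW xr) _.
    by rewrite lerDr.
  - move=> x y Kx Ky; rewrite /eball /= subr0; apply: le_lt_trans drho.
    by rewrite -[y]opprK; exact: Kd.
rewrite ler_pXn2r ?nnegrE ?mulr_ge0 ?exprn_ge0 ?(ltW rho0) ?(ltW w0)// => h2.
by rewrite expr_div_n mulrA ler_pdivlMr ?exprn_gt0// mulrC [leRHS]mulrC.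
Qed.

End isodiametric.

(** * Volumes of thin cones *)

Section measurable_euclid.
Context d (T : measurableType d) (R : realType) (n : nat).

Lemma measurable_dotp (f g : T -> 'rV[R]_n) :
  (forall i, measurable_fun setT (fun t => f t ord0 i)) ->
  (forall i, measurable_fun setT (fun t => g t ord0 i)) ->
  measurable_fun setT (fun t => dotp (f t) (g t)).
Proof.
by move=> mf mg; apply: measurable_sum => i; exact: measurable_funM.
Qed.

Lemma measurable_enorm (f : T -> 'rV[R]_n) :
  (forall i, measurable_fun setT (fun t => f t ord0 i)) ->
  measurable_fun setT (fun t => enorm (f t)).
Proof.
move=> mf.
rewrite (_ : (fun t => _) = (fun t => dotp (f t) (f t) `^ 2^-1)).
  by apply: (measurableT_comp (measurable_powR _)); exact: measurable_dotp.
by apply/funext => t; rewrite powR12_sqrt// dotp_ge0.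
Qed.

Lemma measurable_inv (f : T -> R) : (forall t, 0 <= f t) ->
  measurable_fun setT f -> measurable_fun setT (fun t => (f t)^-1).
Proof.
move=> f0 mf; rewrite (_ : (fun t => _) = (fun t => f t `^ (-1))).
  exact: (measurableT_comp (measurable_powR _)).
by apply/funext => t; rewrite powR_inv1.
Qed.

End measurable_euclid.

Lemma integral_monomial (R : realType) m :
  (\int[lebesgue_measure]_(t in `[0%R, 1%R]) (t ^+ m)%:E = (m.+1%:R^-1)%:E :> \bar R)%E.
Proof.
rewrite (@continuous_FTC2 _ _ (fun t => t ^+ m.+1 * m.+1%:R^-1))//=.
- by rewrite expr1n expr0n/= mul0r mul1r sube0.
- by apply: continuous_in_subspaceT => x x01; exact: exprn_continuous.
- split.
  + by move=> y y01; apply: derivableM => //=; exact: exprn_derivable.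
  + apply: cvgM; last exact: cvg_cst.
    by apply: cvg_at_right_filter; exact: exprn_continuous.
  + apply: cvgM; last exact: cvg_cst.
    by apply: cvg_at_left_filter; exact: exprn_continuous.
- move=> x x01; rewrite derive1Mr//; last exact: exprn_derivable.
  by rewrite exp_derive1 mulrAC divff// mul1r.
Qed.

Section cones.
Context (R : realType) (m : nat).
Implicit Types (G : set 'rV[R]_m.+1) (r d : R).

(** The part in the open unit ball of the cone of vertex 0 over G. *)
Definition cone G : set 'rV[R]_m.+1 :=
  [set x | enorm x < 1 /\ exists s, exists2 u, G u & 0 <= s /\ x = s *: u].

(** Away from the vertex, x is in the cone if and only if its radial projection
    to the sphere of radius r is in G, and this projection is measurable. *)
Lemma measurable_cone G r : 0 < r -> closed G -> G !=set0 ->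
  (forall u, G u -> enorm u = r) -> measurable (cone G : set (space R m.+1)).
Proof.
move=> r0 cG [p Gp] Gr.
pose f (x : space R m.+1) : space R m.+1 :=
  (r / enorm (x : 'rV_m.+1)) *: (x : 'rV_m.+1).
rewrite (_ : cone G = eball 0 1 `&` ([set 0] `|` f @^-1` G)).
  apply: measurableI; first exact: measurable_eball.
  apply: measurableU.
    apply: closed_measurable_space.
    rewrite (_ : [set 0] = [set y | enorm (y - 0) = 0]); first exact: closed_sphere.
    apply/seteqP; split=> x; rewrite /= subr0; first by move=> ->; rewrite enorm0.
    by move/eqP; rewrite enorm_eq0 => /eqP.
  apply: measurable_space_preimage; last exact: closed_measurable_space.
  apply: measurable_to_space => i; rewrite /f; under eq_fun do rewrite mxE.
  apply: measurable_funM; last exact: measurable_coord.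
  apply: measurable_funM => //; apply: measurable_inv; first by move=> t; exact: enorm_ge0.
  by apply: measurable_enorm => j; exact: measurable_coord.
apply/seteqP; split=> [x [x1 [s [u Gu [s0 xE]]]]|x [x1 [->|Gx]]].
- split; first by rewrite /eball /= subr0.
  move: s0; rewrite le_eqVlt => /predU1P[s0|s0]; first by left; rewrite /= xE -s0 scale0r.
  right; rewrite /f /= xE enormZ (Gr u Gu) gtr0_norm// scalerA.
  by rewrite (_ : _ * _ = 1) ?scale1r//; field; rewrite !gt_eqF.
- split; first by rewrite enorm0.
  by exists 0, p => //; rewrite scale0r.
- split; first by move: x1; rewrite /eball /= subr0.
  have xN0 : enorm x != 0.
    apply/eqP => h; move: (Gr _ Gx); rewrite /f h invr0 mulr0 scale0r enorm0 => h'.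
    by move: r0; rewrite -h' ltxx.
  exists (enorm x / r), (f x) => //; split; first by rewrite divr_ge0 ?enorm_ge0// ltW.
  rewrite /f scalerA (_ : _ * _ = 1) ?scale1r//; field.
  by rewrite xN0 gt_eqF.
Qed.

Lemma dotp_row_cons (s t : R) (v w : 'rV[R]_m) :
  dotp (row_cons (s, v) : 'rV_m.+1) (row_cons (t, w)) = s * t + dotp v w.
Proof.
rewrite /dotp big_ord_recl !row_cons0; congr (_ + _).
by apply: eq_bigr => i _; rewrite !row_consS.
Qed.

Lemma enorm_row_cons_tail (s : R) (v : 'rV[R]_m) :
  enorm v <= enorm (row_cons (s, v) : 'rV_m.+1).
Proof.
rewrite -(@ler_pXn2r _ 2)// ?nnegrE ?enorm_ge0//.
by rewrite !enorm_sqr dotp_row_cons lerDr -expr2 sqr_ge0.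
Qed.

(** A point (t, x) of the cone is s u with u = (u1, u2) in G, so that
    x = t u2 / u1. The point q = (r, 0) of G forces |u1 - r| and |u2| to be at
    most d, and u2 / u1 - w2 / w1 is estimated by splitting it into
    (u2 - w2) / u1 and (1 / u1 - 1 / w1) w2. *)
Lemma slice_cone_diam G r d delta t (x y : 'rV[R]_m) : 0 < r ->
  delta < r -> 0 <= d <= delta ->
  (forall u v, G u -> G v -> enorm (u - v) <= d) ->
  G (row_cons (r, 0 : 'rV[R]_m)) ->
  slice (cone G : set (space R m.+1)) t x ->
  slice (cone G : set (space R m.+1)) t y ->
  0 <= t <= 1 /\ enorm (x - y) <= t * (r / (r - delta) ^+ 2 * d).
Proof.
move=> r0 dr /andP[d0 dd] Gd Gq [x1 [s [u Gu [s0 xE]]]] [_ [s' [w Gw [s'0 yE]]]].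
have h0 : 0 < r - delta by rewrite subr_gt0.
have decomp (v : 'rV[R]_m.+1) : exists a b, v = row_cons (a, b : 'rV[R]_m).
  by exists (row_split v).1, (row_split v).2; rewrite -surjective_pairing row_splitK.
have subE a a' (b b' : 'rV[R]_m) :
    (row_cons (a, b) : 'rV_m.+1) - row_cons (a', b') = row_cons (a - a', b - b').
  apply/rowP => i; rewrite [LHS]mxE [X in _ + X]mxE.
  have [j ->|->] := unliftP ord0 i; first by rewrite !row_consS !mxE.
  by rewrite !row_cons0.
have scaleE a a' (b' : 'rV[R]_m) :
    a *: (row_cons (a', b') : 'rV_m.+1) = row_cons (a * a', a *: b').
  apply/rowP => i; rewrite [LHS]mxE.
  have [j ->|->] := unliftP ord0 i; first by rewrite !row_consS !mxE.
  by rewrite !row_cons0.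
have [u1 [u2 uE]] := decomp u; have [w1 [w2 wE]] := decomp w.
rewrite {}uE in Gu xE; rewrite {}wE in Gw yE.
rewrite scaleE in xE; rewrite scaleE in yE.
have /(congr1 (@row_split R m)) := xE; rewrite !row_consK => -[tE vE].
have /(congr1 (@row_split R m)) := yE; rewrite !row_consK => -[tE' vE'].
have head_le a (b : 'rV[R]_m) : `|a| <= enorm (row_cons (a, b) : 'rV_m.+1).
  by have := le_coord_enorm (row_cons (a, b) : 'rV_m.+1) ord0; rewrite row_cons0.
have near a (b : 'rV[R]_m) : G (row_cons (a, b)) -> `|a - r| <= d /\ enorm b <= d.
  move=> Gab; have := Gd _ _ Gab Gq; rewrite subE subr0 => h.
  by split; apply: le_trans h; [exact: head_le|exact: enorm_row_cons_tail].
have [u1r u2d] := near _ _ Gu; have [w1r w2d] := near _ _ Gw.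
have := Gd _ _ Gu Gw; rewrite subE => uw.
have uw1 : `|u1 - w1| <= d by apply: le_trans uw; exact: head_le.
have uw2 : enorm (u2 - w2) <= d by apply: le_trans uw; exact: enorm_row_cons_tail.
have u1h : r - delta <= u1 by move: u1r; rewrite ler_norml => /andP[]; lra.
have w1h : r - delta <= w1 by move: w1r; rewrite ler_norml => /andP[]; lra.
have u10 : 0 < u1 by exact: lt_le_trans u1h.
have w10 : 0 < w1 by exact: lt_le_trans w1h.
have t0 : 0 <= t by rewrite tE mulr_ge0// ltW.
split.
  rewrite t0 /= (le_trans (ler_norm t))// (le_trans (head_le t x))//.
  exact: ltW.
have -> : x - y = t *: (u1^-1 *: (u2 - w2) + (u1^-1 - w1^-1) *: w2).
  rewrite vE vE' scalerDr !scalerA scalerBr.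
  rewrite (_ : t * u1^-1 = s) ?tE ?mulfK ?gt_eqF// -tE.
  rewrite mulrBr scalerBl {1}tE mulfK ?gt_eqF// tE' mulfK ?gt_eqF//.
  by rewrite addrA subrK.
rewrite enormZ ger0_norm// ler_wpM2l//.
apply: (le_trans (enormD _ _)); rewrite !enormZ gtr0_norm ?invr_gt0//.
rewrite (_ : u1^-1 - w1^-1 = (w1 - u1) / (u1 * w1)); last first.
  by field; rewrite !gt_eqF.
rewrite normrM (gtr0_norm (_ : 0 < (u1 * w1)^-1)) ?invr_gt0 ?mulr_gt0// distrC.
apply: (@le_trans _ _ ((r - delta)^-1 * d + d / (r - delta) ^+ 2 * delta)).
  apply: lerD.
    by apply: ler_pM; rewrite ?invr_ge0 ?enorm_ge0 ?(ltW u10)// lef_pV2 ?posrE.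
  apply: ler_pM => //; rewrite ?enorm_ge0//; last exact: le_trans w2d dd.
    by rewrite mulr_ge0// invr_ge0 mulr_ge0// ltW.
  apply: ler_pM => //; first by rewrite invr_ge0 mulr_ge0// ltW.
  rewrite lef_pV2 ?posrE ?exprn_gt0 ?mulr_gt0// expr2.
  by apply: ler_pM => //; exact: ltW.
rewrite le_eqVlt; apply/orP; left; apply/eqP; field.
by rewrite gt_eqF.
Qed.

(** Slice the cone along its axis and apply the isodiametric inequality to each
    slice; the integral of t^m over [0, 1] produces the factor 1 / (m + 1). *)
Lemma vol_cone_axis G r d delta : (0 < r) -> delta < r -> 0 <= d <= delta ->
  measurable (cone G : set (space R m.+1)) ->
  (forall u v, G u -> G v -> enorm (u - v) <= d) ->
  G (row_cons (r, 0 : 'rV[R]_m)) ->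
  (vol R m.+1 (cone G) <=
   ((r / (r - delta) ^+ 2) ^+ m / m.+1%:R * (omega R m * (d / 2) ^+ m))%:E)%E.
Proof.
move=> r0 dr dd mC Gd Gq; have h0 : 0 < r - delta by rewrite subr_gt0.
have d0 : 0 <= d by case/andP: dd.
pose kap := r / (r - delta) ^+ 2.
have kap0 : 0 <= kap by rewrite divr_ge0 ?exprn_ge0 ?ltW.
pose c := kap ^+ m * (omega R m * (d / 2) ^+ m).
have c0 : 0 <= c.
  apply: mulr_ge0; first exact: exprn_ge0.
  by apply: mulr_ge0; [exact/ltW/omega_gt0|exact/exprn_ge0/divr_ge0].
pose p := (EFin \o (fun t : R => t ^+ m)) \_ `[0, 1].
have mp : measurable_fun setT p.
  apply/(measurable_restrictT _ _).1 => //; apply/measurable_EFinP.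
  by apply: measurable_funTS; exact: exprn_measurable.
have p0 t : (0 <= p t)%E.
  rewrite /p patchE; case: ifPn => //.
  by rewrite inE /= in_itv /= lee_fin => /andP[t0 _]; exact: exprn_ge0.
rewrite vol_slice.
apply: (@le_trans _ _ (\int[lebesgue_measure]_t (c%:E * p t))%E).
  apply: ge0_le_integral => //.
  - exact: measurable_vol_slice.
  - exact: measurable_funeM.
  move=> t _; have mS := @measurable_slice R m _ t mC.
  have [S0|/set0P[x Sx]] := eqVneq (slice (cone G : set (space R m.+1)) t) set0.
    by rewrite S0 measure0 mule_ge0.
  have [t01 _] := slice_cone_diam r0 dr dd Gd Gq Sx Sx.
  have t0 : 0 <= t by case/andP: t01.
  rewrite /p patchE mem_set /= ?in_itv//.
  apply: (@le_trans _ _ (omega R m * (t * (kap * d) / 2) ^+ m)%:E).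
    apply: isodiametric => //; first exact: (mulr_ge0 t0 (mulr_ge0 kap0 d0)).
    by move=> y z Sy Sz; have [] := slice_cone_diam r0 dr dd Gd Gq Sy Sz.
  rewrite -EFinM lee_fin /c -!mulrA !exprMn.
  by rewrite le_eqVlt; apply/orP; left; apply/eqP; ring.
rewrite ge0_integralZl// -integral_mkcond integral_monomial -EFinM lee_fin /c.
by rewrite le_eqVlt; apply/orP; left; apply/eqP; ring.
Qed.

(** The reflection exchanging a point p of G with (r, 0) reduces to a cone
    whose base contains (r, 0). *)
Lemma vol_cone G r d delta : 0 < r -> delta < r -> 0 <= d <= delta ->
  closed G -> G !=set0 -> (forall u, G u -> enorm u = r) ->
  (forall u v, G u -> G v -> enorm (u - v) <= d) ->
  (vol R m.+1 (cone G) <=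
   ((r / (r - delta) ^+ 2) ^+ m / m.+1%:R * (omega R m * (d / 2) ^+ m))%:E)%E.
Proof.
move=> r0 dr dd cG G0 Gr Gd; have mC := measurable_cone r0 cG G0 Gr.
have [p Gp] := G0.
pose q : 'rV[R]_m.+1 := row_cons (r, 0 : 'rV[R]_m).
have qr : enorm q = r.
  rewrite /enorm dotp_row_cons (_ : dotp 0 0 = 0) ?addr0.
    by rewrite -expr2 sqrtr_sqr gtr0_norm.
  by rewrite -enorm_sqr enorm0 expr0n.
pose Q := reflection (p - q).
have Qq : Q q = p.
  have <- : Q p = q by apply: reflection_to; rewrite qr Gr.
  exact: reflectionK.
have coneE : Q @^-1` cone G = cone (Q @^-1` G).
  apply/seteqP; split=> x; rewrite /cone /= enorm_reflection.
    move=> [x1 [s [u Gu [s0 xE]]]]; split=> //; exists s, (Q u).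
      by rewrite /preimage /mkset /Q reflectionK.
    by split=> //; rewrite /Q -reflectionZ -xE reflectionK.
  move=> [x1 [s [u Gu [s0 xE]]]]; split=> //; exists s, (Q u) => //.
  by split=> //; rewrite /Q xE reflectionZ.
rewrite -(vol_reflection (p - q) mC) -/Q coneE; apply: vol_cone_axis => //.
- by rewrite -coneE; exact: (measurable_space_preimage (measurable_reflection _) mC).
- move=> u v Gu Gv; rewrite -(enorm_reflection (p - q)) reflectionB.
  exact: Gd.
- by rewrite /= Qq.
Qed.

End cones.

(** * Lower bound for the Hausdorff measure of a sphere *)

Section sphere.
Context (R : realType) (m : nat) (r : R).
Hypothesis r0 : 0 < r.

Let S : set 'rV[R]_m.+1 := [set x | enorm x = r].

(** The cones over the pieces of a covering of the sphere cover the unit ball.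
    Each piece is replaced by its closure, which has the same diameter and
    makes the cone measurable. *)
Lemma ball_le_gauge_series delta (F : (set 'rV[R]_m.+1)^nat) :
  0 < delta -> delta < r -> delta_cover delta S F ->
  ((omega R m.+1)%:E <= ((r / (r - delta) ^+ 2) ^+ m / m.+1%:R)%:E *
     \sum_(i <oo) hausdorff_gauge m (F i))%E.
Proof.
move=> d0 dr [SF Fd]; set a := _ / _.
have a0 : 0 <= a.
  by rewrite divr_ge0 ?exprn_ge0 ?divr_ge0 ?exprn_ge0 ?(ltW r0)// subr_ge0 ltW.
pose G i : set 'rV[R]_m.+1 := closure (F i) `&` S.
have cG i : closed (G i).
  apply: closedI; first exact: closed_closure.
  rewrite (_ : S = [set x | enorm (x - 0) = r]); first exact: closed_sphere.
  by apply/seteqP; split=> x; rewrite /S /= subr0.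
have GS i u : G i u -> enorm u = r by case.
have [G0|G0] := pselect (forall i, G i = set0 \/ G i !=set0); last first.
  by exfalso; apply: G0 => i; have [->|/set0P] := eqVneq (G i) set0; [left|right].
have mC i : measurable (cone (G i) : set (space R m.+1)).
  have [->|] := G0 i; last by move=> Gi; exact: measurable_cone r0 (cG i) Gi (GS i).
  rewrite (_ : cone set0 = set0)//.
  by apply/seteqP; split=> x // [_ [s [u []]]].
have ball_cone : eball (0 : 'rV[R]_m.+1) 1 `<=` \bigcup_i cone (G i).
  move=> x; rewrite /eball /= subr0 => x1.
  have [->|xN0] := eqVneq x 0.
    (* the vertex 0 belongs to the cone over any piece that meets the sphere *)
pose q : 'rV[R]_m.+1 := r *: row_cons (1, 0 : 'rV[R]_m).
    have Sq : S q.
      rewrite /S /= /q enormZ gtr0_norm// /enorm dotp_row_cons mulr1.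
      by rewrite -(enorm_sqr (0 : 'rV[R]_m)) enorm0 expr0n addr0 sqrtr1 mulr1.
    have [i _ Fq] := SF _ Sq; exists i => //; split; first by rewrite enorm0.
    exists 0, q; last by rewrite scale0r.
    by split=> //; exact: subset_closure.
  have e0 : 0 < enorm x by rewrite enorm_gt0.
  have Su : S ((r / enorm x) *: x).
    by rewrite /S /= enormZ gtr0_norm ?divr_gt0// divfK// gt_eqF.
  have [i _ Fu] := SF _ Su; exists i => //; split=> //.
  exists (enorm x / r), ((r / enorm x) *: x).
    by split=> //; exact: subset_closure.
  split; first by rewrite divr_ge0// ltW.
  rewrite scalerA (_ : _ * _ = 1) ?scale1r//; field.
  by rewrite !gt_eqF.
rewrite -(vol_unit_ball R m.+1).1.
apply: (@le_trans _ _ (\sum_(i <oo) vol R m.+1 (cone (G i)))%E).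
  apply: measure_sigma_subadditive => //; exact: measurable_eball.
rewrite -nneseriesZl; last by move=> i _; exact: hausdorff_gauge_ge0.
apply: lee_nneseries => // i _.
have [Gi|] := G0 i.
  rewrite Gi (_ : cone set0 = set0) ?measure0.
    by rewrite mule_ge0 ?lee_fin// hausdorff_gauge_ge0.
  by apply/seteqP; split=> x // [_ [s [u []]]].
move=> Gi; have [u [Fu _]] := Gi.
have Fi : F i !=set0.
  by have /closure_eballP/(_ 1 ltr01)[y Fy _] := Fu; exists y.
have dge0 := ediam_ge0 Fi.
have dfin : ediam (F i) \is a fin_num.
  by rewrite ge0_fin_numE//; apply: le_lt_trans (Fd i) _; rewrite ltry.
pose d := fine (ediam (F i)); have dE : ediam (F i) = d%:E by rewrite fineK.
have dd : 0 <= d <= delta by rewrite -!lee_fin -dE dge0 Fd.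
have Gd : forall u v, G i u -> G i v -> enorm (u - v) <= d.
  move=> v w [Fv _] [Fw _]; apply: closure_diam Fv Fw => x y Fx Fy.
  by rewrite -lee_fin -dE; apply: ereal_sup_ubound; exists (x, y).
apply: le_trans (vol_cone r0 dr dd (cG i) Gi (GS i) Gd) _.
rewrite EFinM -/a lee_wpmul2l ?lee_fin// /hausdorff_gauge.
rewrite (negbTE (_ : F i != set0)); last exact/set0P.
by rewrite dE -EFin_expe -EFinM lee_fin expr_div_n mulrA [leRHS]mulrAC.
Qed.

(** Let delta tend to 0 in [ball_le_gauge_series]: the factor r / (r - delta)^2
    tends to 1 / r. *)
Lemma sphere_le_hausdorff : ((m.+1%:R * omega R m.+1 * r ^+ m)%:E <= hausdorff m S)%E.
Proof.
set H := hausdorff m S.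
have H0 : (0 <= H)%E by exact: hausdorff_ge0.
have key delta : 0 < delta < r ->
    ((omega R m.+1)%:E <= ((r / (r - delta) ^+ 2) ^+ m / m.+1%:R)%:E * H)%E.
  move=> /andP[d0 dr]; set a := _ / _.
  have a0 : 0 < a.
    by rewrite divr_gt0// exprn_gt0// divr_gt0// exprn_gt0// subr_gt0.
  rewrite -lee_pdivrMl//.
  apply: (@le_trans _ _ (hausdorff_delta m delta S)).
    apply: le_ereal_inf_tmp => _ [F FS <-].
    by rewrite lee_pdivrMl//; exact: ball_le_gauge_series.
  by apply: ereal_sup_ubound; exists delta.
have [Hfin|] := boolP (H \is a fin_num); last first.
  by rewrite ge0_fin_numE// -leNgt leye_eq => /eqP ->; rewrite leey.
rewrite -(fineK Hfin) lee_fin.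
pose g delta := (r / (r - delta) ^+ 2) ^+ m / m.+1%:R * fine H.
have : omega R m.+1 <= g 0.
  apply: (@le_at_right_limit R g 0 r) => //; last first.
    by move=> delta /key; rewrite -(fineK Hfin) -EFinM lee_fin.
  apply: cvgM; last exact: cvg_cst.
  apply: cvgM; last exact: cvg_cst.
  apply: (@cvg_comp _ _ _ (fun t => r / (r - t) ^+ 2) (fun t => t ^+ m) _
    (nbhs (r / (r - 0) ^+ 2))).
    apply: cvgM; first exact: cvg_cst.
    apply: cvgV; first by rewrite subr0 expf_neq0// gt_eqF.
    apply: (@cvg_comp _ _ _ (fun t => r - t) (fun t => t ^+ 2) _ (nbhs (r - 0))).
      by apply: cvgB; [exact: cvg_cst|exact: cvg_id].
    exact: exprn_continuous.
  exact: exprn_continuous.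
rewrite /g subr0 (_ : r / r ^+ 2 = r^-1); last by field; rewrite gt_eqF.
rewrite exprVn -mulrA mulrC -[X in _ <= X -> _]mulrA => h.
rewrite -ler_pdivlMr ?exprn_gt0// mulrC -ler_pdivlMr//.
by rewrite mulrC in h.
Qed.

End sphere.

(** * Closed sets are Caratheodory measurable for Hausdorff measures *)

Section metric_outer_measure.
Context (R : realType) (n k : nat).
Implicit Types A B X : set 'rV[R]_n.

Lemma ediam_set0 : ediam (set0 : set 'rV[R]_n) = -oo%E.
Proof.
by rewrite /ediam (_ : [set _ | _ in _] = set0) ?ereal_sup0// -subset0 => _ [p [[]]].
Qed.

Lemma le_hausdorff_delta (d1 d2 : R) A : d1 <= d2 ->
  (hausdorff_delta k d2 A <= hausdorff_delta k d1 A)%E.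
Proof.
move=> d12; apply: le_ereal_inf_tmp => _ [F [AF Fd] <-]; apply: ereal_inf_lbound.
by exists F => //; split=> // i; rewrite (le_trans (Fd i))// lee_fin.
Qed.

(** A set of diameter at most delta < e cannot meet both A and B, so a covering
    of the union splits into a covering of A and one of B. *)
Lemma hausdorff_delta_separated (delta e : R) A B : delta < e ->
  (forall x y, A x -> B y -> e <= enorm (x - y)) ->
  (hausdorff_delta k delta A + hausdorff_delta k delta B <=
   hausdorff_delta k delta (A `|` B))%E.
Proof.
move=> de AB; apply: le_ereal_inf_tmp => _ [F [ABF Fd] <-].
pose FA i := if pselect (F i `&` A !=set0) then F i else set0.
pose FB i := if pselect (F i `&` A !=set0) then set0 else F i.
have cA : delta_cover delta A FA.
  split=> [x Ax|i].
    have [i _ Fx] := ABF x (or_introl Ax); exists i => //.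
    by rewrite /FA; case: pselect => // h; exfalso; apply: h; exists x.
  by rewrite /FA; case: pselect => h; [exact: Fd|rewrite ediam_set0 leNye].
have cB : delta_cover delta B FB.
  split=> [y By|i].
    have [i _ Fy] := ABF y (or_intror By); exists i => //.
    rewrite /FB; case: pselect => // -[x [Fx Ax]].
    have := lt_le_trans de (AB x y Ax By); rewrite ltNge => /negP; case.
    rewrite -lee_fin (le_trans _ (Fd i))//; apply: ereal_sup_ubound.
    by exists (x, y).
  by rewrite /FB; case: pselect => h; [rewrite ediam_set0 leNye|exact: Fd].
apply: (@le_trans _ _ (\sum_(i <oo) hausdorff_gauge k (FA i) +
                       \sum_(i <oo) hausdorff_gauge k (FB i))%E).
  by apply: leeD; apply: ereal_inf_lbound; [exists FA|exists FB].
rewrite -nneseriesD; try by move=> i _ _; exact: hausdorff_gauge_ge0.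
apply: lee_nneseries => i _.
  by rewrite adde_ge0// hausdorff_gauge_ge0.
rewrite /FA /FB; case: pselect => h; first by rewrite hausdorff_gauge0 adde0.
by rewrite hausdorff_gauge0 add0e.
Qed.

Lemma hausdorff_separated (e : R) A B : 0 < e ->
  (forall x y, A x -> B y -> e <= enorm (x - y)) ->
  (hausdorff k A + hausdorff k B <= hausdorff k (A `|` B))%E.
Proof.
move=> e0 AB; set c := hausdorff k (A `|` B).
have c0 : (0 <= c)%E by exact: hausdorff_ge0.
have [cfin|] := boolP (c \is a fin_num); last first.
  by rewrite ge0_fin_numE// -leNgt leye_eq => /eqP ->; rewrite leey.
have fin X : X `<=` A `|` B -> hausdorff k X \is a fin_num.
  move=> XAB; rewrite ge0_fin_numE; last exact: hausdorff_ge0.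
  by apply: le_lt_trans (@le_hausdorff R n k _ _ XAB) _; rewrite -ge0_fin_numE.
apply/lee_addgt0Pr => t t0; have t20 : 0 < t / 2 by rewrite divr_gt0.
have [_ [d1 /= d10 <-] h1] := ub_ereal_sup_adherent t20 (fin A (@subsetUl _ A B)).
have [_ [d2 /= d20 <-] h2] := ub_ereal_sup_adherent t20 (fin B (@subsetUr _ A B)).
(* smaller than e, so that coverings of diameter d split *)
pose d := Num.min (Num.min d1 d2) (e / 2).
have d0 : 0 < d by rewrite !lt_min d10 d20 divr_gt0.
have de : d < e.
  by rewrite gt_min ltr_pdivrMr// ltr_pMr// ltr1n orbT.
apply: (@le_trans _ _ (hausdorff_delta k d (A `|` B) + t%:E)%E); last first.
  by rewrite leeD2r//; apply: ereal_sup_ubound; exists d.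
apply: (@le_trans _ _
  (hausdorff_delta k d A + hausdorff_delta k d B + t%:E)%E); last first.
  by rewrite leeD2r//; exact: hausdorff_delta_separated AB.
rewrite (splitr t) EFinD addeACA; apply: leeD.
- rewrite -leeBlDr//; apply: le_trans (ltW h1) _.
  by apply: le_hausdorff_delta; rewrite /d !ge_min lexx.
- rewrite -leeBlDr//; apply: le_trans (ltW h2) _.
  by apply: le_hausdorff_delta; rewrite /d !ge_min lexx orbT.
Qed.

Section closed_measurable.
Variables (A : set 'rV[R]_n) (cA : closed A).

Let gap (j : nat) : R := j.+1%:R^-1.
Let far j : set 'rV[R]_n := [set x | forall y, A y -> gap j <= enorm (x - y)].

Let gap_gt0 j : 0 < gap j. Proof. by rewrite invr_gt0. Qed.

Let gap_lt i j : (i < j)%N -> gap j < gap i.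
Proof. by move=> ij; rewrite ltf_pV2 ?posrE// ltr_nat. Qed.

Let gap_le i j : (i <= j)%N -> gap j <= gap i.
Proof. by move=> ij; rewrite lef_pV2 ?posrE// ler_nat. Qed.

Let far_le i j : (i <= j)%N -> far i `<=` far j.
Proof. by move=> ij x xi y Ay; exact: le_trans (gap_le ij) (xi y Ay). Qed.

Let ring (X : set 'rV[R]_n) j := X `&` (far j.+1 `\` far j).

(** Two rings that are not adjacent are at a positive distance from each
    other. *)
Let every_other_ring X b N :
  (\sum_(0 <= i < N) hausdorff k (ring X (i.*2 + b)) <=
   hausdorff k (X `&` \bigcup_(i in `I_N) ring X (i.*2 + b)))%E.
Proof.
elim: N => [|N IH]; first by rewrite big_geq// hausdorff_ge0.
rewrite big_nat_recr//=.
apply: (le_trans (leeD2r _ IH)).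
have [->|N0] := posnP N.
  rewrite [X in hausdorff k X](_ : _ = set0); last first.
    by rewrite -subset0 => x [_ [i]].
  rewrite hausdorff0 add0e; apply: le_hausdorff => x Rx.
  by split; [case: Rx|exists 0%N].
(* a lower bound for the distance from ring 2N + b to ring 2(N-1) + b, hence
   to all the previous ones *)
pose g := gap (N.-1.*2 + b).+1 - gap (N.-1.*2 + b).+2.
have g0 : 0 < g by rewrite subr_gt0 gap_lt.
apply: le_trans (hausdorff_separated g0 _) _.
  move=> x y [_ [i /= iN Rx]] Ry.
  case: Rx => _ [xi _]; case: Ry => _ [_ yj].
  have [w Aw yw] : exists2 w, A w & enorm (y - w) < gap (N.*2 + b).
    apply: contrapT => h; apply: yj => w Aw; rewrite leNgt; apply/negP => yw.
    by apply: h; exists w.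
  have h1 : gap (N.-1.*2 + b).+1 <= gap (i.*2 + b).+1.
    by apply: gap_le; rewrite ltnS leq_add2r leq_double -ltnS prednK.
  have h2 : gap (N.*2 + b) <= gap (N.-1.*2 + b).+2.
    by apply: gap_le; rewrite -{2}(prednK N0) doubleS !addSn.
  have := xi w Aw; have := enorm_dist_trans y x w; rewrite /g; lra.
apply: le_hausdorff => x [[Xx [i /= iN Rx]]|Rx].
  by split=> //; exists i => //=; exact: ltnW.
by split; [case: Rx|exists N => /=].
Qed.

Let ring_tail X b : (hausdorff k X < +oo)%E ->
  (\sum_(N <= i <oo) hausdorff k (ring X (i.*2 + b)))%E @[N --> \oo] --> (0 : \bar R)%E.
Proof.
move=> Xoo; apply: nneseries_tail_cvg; last by move=> *; exact: hausdorff_ge0.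
apply: le_lt_trans Xoo; apply: lime_le.
  by apply: is_cvg_nneseries => *; exact: hausdorff_ge0.
apply: nearW => N; apply: le_trans (every_other_ring X b N) _.
by apply: le_hausdorff => x [].
Qed.

(** A point of X outside the closed set A is far from A at some first scale l;
    it lies in the ring l - 1, and the parity of l - 1 decides between the two
    unions. *)
Let diff_sub X j : X `\` A `<=` (X `&` far j.*2) `|`
  (\bigcup_(i in ~` `I_j) ring X (i.*2 + 0) `|`
   \bigcup_(i in ~` `I_j) ring X (i.*2 + 1)).
Proof.
move=> x [Xx Ax].
have [xj|xj] := pselect (far j.*2 x); [by left|right].
have /nbhs_eballP[e e0 eA] : nbhs x (~` A).
  by apply: open_nbhs_nbhs; split=> //; rewrite openC.
have [N _ /(_ N (leqnn N)) /= Ne] := near_infty_natSinv_lt (PosNum e0).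
have xN : far N x.
  move=> y Ay; rewrite leNgt; apply/negP => xy; apply: (eA y) => //.
  by rewrite /eball /= enorm_distC; exact: lt_trans xy Ne.
have exN : exists i, `[< far i x >] by exists N; apply/asboolP.
case: (ex_minnP exN) => l /asboolP xl lmin.
have jl : (j.*2 < l)%N.
  by rewrite ltnNge; apply/negP => lj; apply: xj; exact: far_le lj _ xl.
have Rl : ring X l.-1 x.
  split=> //; split; first by rewrite prednK// (leq_ltn_trans _ jl).
  move=> /asboolP/lmin; rewrite leqNgt prednK// ?leqnn//.
  exact: leq_ltn_trans jl.
have jl' : (j.*2 <= l.-1)%N by rewrite -ltnS prednK// (leq_ltn_trans _ jl).
have jh : (j <= l.-1./2)%N by rewrite -[j]doubleK half_leq.
have lE := odd_double_half l.-1.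
case: (odd l.-1) lE => lE; [right|left]; exists (l.-1./2) => /=.
- by apply/negP; rewrite -leqNgt.
- by rewrite addnC lE.
- by apply/negP; rewrite -leqNgt.
- by rewrite addnC lE.
Qed.

(** Caratheodory's criterion: X minus A is exhausted by the points of X that are
    far from A, up to rings X_j around A. The series of the measures of every
    other ring is bounded by the measure of X, so that its tails, which
    measure what is left over, tend to 0. *)
Lemma closed_caratheodory : (hausdorff_outer R n k).-caratheodory A.
Proof.
apply: le_caratheodory_measurable => X.
change (hausdorff k (X `&` A) + hausdorff k (X `\` A) <= hausdorff k X)%E.
have [Xoo|] := ltP (hausdorff k X) +oo%E; last first.
  by rewrite leye_eq => /eqP ->; rewrite leey.
pose t b N := (\sum_(N <= i <oo) hausdorff k (ring X (i.*2 + b)))%E.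
have tcvg : (hausdorff k X + (t 0%N N + t 1%N N))%E @[N --> \oo] --> hausdorff k X.
  rewrite -[X in _ --> X]adde0 -[X in _ --> (_ + X)%E]adde0.
  have Xfin : hausdorff k X \is a fin_num by rewrite ge0_fin_numE// hausdorff_ge0.
  apply: cvgeD; [|exact: cvg_cst|].
    by rewrite adde0 fin_num_adde_defr.
  by apply: cvgeD; [rewrite fin_num_adde_defr|exact: ring_tail|exact: ring_tail].
apply: (cvge_to_ge tcvg); apply: nearW => j.
apply: (@le_trans _ _ (hausdorff k (X `&` A) + (hausdorff k (X `&` far j.*2) +
    (t 0%N j + t 1%N j)))%E).
  rewrite leeD2l//; apply: le_trans (@le_hausdorff R n k _ _ (@diff_sub X j)) _.
  apply: le_trans (@outer_measureU2 _ _ (hausdorff_outer R n k) _ _) _.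
  rewrite leeD2l//; apply: le_trans (@outer_measureU2 _ _ (hausdorff_outer R n k) _ _) _.
  by apply: leeD; exact: (@outer_measure_sigma_subadditive_tail _ _ (hausdorff_outer R n k)).
rewrite addeA leeD2r//.
apply: le_trans (@hausdorff_separated (gap j.*2) _ _ (gap_gt0 _) _) _.
  by move=> x y [_ Ax] [_ fy]; rewrite enorm_distC; exact: fy.
by apply: le_hausdorff => x [[]|[]].
Qed.

End closed_measurable.
End metric_outer_measure.

(** * Translation invariance of the surface measure *)

Section translation.
Context (R : realType) (n : nat).
Implicit Types (A : set 'rV[R]_n) (a : 'rV[R]_n).

Let shift a (x : 'rV[R]_n) : 'rV[R]_n := x + a.

Lemma shift_preimageK a A : shift (- a) @^-1` (shift a @^-1` A) = A.
Proof. by apply/funext => x; rewrite /preimage /mkset /shift subrK. Qed.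

Lemma hausdorff_gauge_shift k a A :
  hausdorff_gauge k (shift a @^-1` A) = hausdorff_gauge k A.
Proof.
have gauge_set0 b B : B = set0 -> shift b @^-1` B = set0.
  by move=> ->; rewrite preimage_set0.
rewrite /hausdorff_gauge; have [->|A0] := eqVneq A set0.
  by rewrite gauge_set0// eqxx.
rewrite ifN_eq; last first.
  by apply: contraNneq A0 => h; rewrite -(shift_preimageK a A) h gauge_set0.
congr (_ * _ ^+ _)%E; congr ereal_sup; apply/seteqP; split=> _ [[x y] [/= Ax Ay] <-].
  by exists (x + a, y + a) => //=; rewrite opprD addrACA subrr addr0.
exists (x - a, y - a) => /=; last by rewrite opprD addrACA subrr addr0.
by split; rewrite /preimage /mkset /shift subrK.
Qed.

(** Diameters are translation invariant, and translating a covering of B gives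
    a covering of its translate. *)
Lemma hausdorff_shift k a A : hausdorff k (shift a @^-1` A) = hausdorff k A.
Proof.
suff le_shift b B : (hausdorff k (shift b @^-1` B) <= hausdorff k B)%E.
  apply/le_anti; rewrite le_shift /=.
  by rewrite -{1}(shift_preimageK a A) le_shift.
apply: ge_ereal_sup => _ [d d0 <-].
apply: le_trans (ereal_sup_ubound _); last by exists d.
apply: le_ereal_inf_tmp => _ [F [BF Fd] <-]; apply: ereal_inf_lbound.
exists (fun i => shift b @^-1` F i); last first.
  by apply: eq_eseriesr => i _; rewrite hausdorff_gauge_shift.
split=> [x /BF[i _ Fi]|i]; first by exists i.
apply: le_trans (Fd i); apply: ge_ereal_sup => _ [[x y] [/= Fx Fy] <-].
apply: ereal_sup_ubound; exists (shift b x, shift b y) => //=.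
by rewrite /shift opprD addrACA subrr addr0.
Qed.

End translation.

Section sigma.
Context (R : realType) (n : nat).
Notation T := (caratheodory_type (hausdorff_outer R n n.-1)).
Implicit Types (A D : set 'rV[R]_n).

Lemma closed_sigma A : closed A -> measurable (A : set T).
Proof. exact: closed_caratheodory. Qed.

Lemma open_sigma A : open A -> measurable (A : set T).
Proof.
move=> oA; rewrite -[A]setCK; apply: measurableC.
by apply: closed_sigma; rewrite closedC.
Qed.

Lemma sigma_coord i : measurable_fun [set: T] (fun x : 'rV[R]_n => x ord0 i).
Proof.
apply: (measurability _ (RGenOpens.measurableE R)).
move=> _ [_ [a [b ->] <-]]; rewrite setTI; apply: open_sigma.
apply: open_comp; last exact: interval_open.
by move=> x _; exact: coord_continuous.
Qed.

Lemma measurable_shift_sigma (a : 'rV[R]_n) :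
  measurable_fun [set: T] (fun x : T => (x : 'rV[R]_n) + a : T).
Proof.
move=> _ A mA; rewrite setTI.
suff : (hausdorff_outer R n n.-1).-caratheodory
  ((fun x : 'rV[R]_n => x + a) @^-1` A) by [].
move=> X.
have := mA ((fun x => x - a) @^-1` X).
have E (Y Z : set 'rV[R]_n) : (fun x => x - a) @^-1` Y `&` Z =
    (fun x => x - a) @^-1` (Y `&` (fun x => x + a) @^-1` Z).
  by apply/seteqP; split=> x; rewrite /preimage /= subrK.
have H Y : hausdorff_outer R n n.-1 ((fun x => x - a) @^-1` Y) =
    hausdorff_outer R n n.-1 Y.
  exact: hausdorff_shift.
by rewrite !E !H.
Qed.

Lemma sigma_integral_shift (a : 'rV[R]_n) (D : set T) (f : 'rV[R]_n -> R) :
  measurable D -> measurable_fun setT (f : T -> R) ->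
  (\int[sigma]_(x in (fun x : 'rV[R]_n => x + a)%R @^-1` D) (f (x + a))%:E =
   \int[sigma]_(x in D) (f x)%:E)%E.
Proof.
move=> mD mf.
have mp : measurable_fun D (EFin \o f : T -> \bar R).
  by apply/measurable_EFinP; exact: measurable_funTS.
rewrite [LHS]integralE [RHS]integralE.
pose M : {measure set T -> \bar R} :=
  measure_function_pushforward__canonical__measure_function_Measure
    (@sigma R n) (measurable_shift_sigma a).
have eqM (g : T -> \bar R) : (\int[sigma]_(x in D) g x = \int[M]_(x in D) g x)%E.
  by apply: eq_measure_integral => A mA _; exact/esym/hausdorff_shift.
have push (g : T -> \bar R) : measurable_fun D g -> (forall x, 0 <= g x)%E ->
   (\int[sigma]_(x in (fun x : 'rV[R]_n => x + a)%R @^-1` D) g (x + a)%R =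
    \int[sigma]_(x in D) g x)%E.
  by move=> mg g0; rewrite eqM (ge0_integral_pushforward (measurable_shift_sigma a)).
have mpos : measurable_fun D ((EFin \o f)^\+)%E by exact: measurable_funepos.
have mneg : measurable_fun D ((EFin \o f)^\-)%E by exact: measurable_funeneg.
have f0 := funepos_ge0 (EFin \o f : T -> \bar R).
have f1 := funeneg_ge0 (EFin \o f : T -> \bar R).
congr (_ - _)%E.
  by apply: etrans (push _ mpos f0); apply: eq_integral => x _; rewrite !funeposE.
by apply: etrans (push _ mneg f1); apply: eq_integral => x _; rewrite !funenegE.
Qed.

End sigma.

(** * The Kuran function near a touching point *)

Section frontier.
Context (R : realType) (n : nat).
Implicit Types (A : set 'rV[R]_n) (a x : 'rV[R]_n).

Lemma image_sub_preimage A a :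
  [set x - a | x in A] = (fun x => x + a) @^-1` A.
Proof.
apply/seteqP; split=> [_ [x Ax <-]|x Ax]; first by rewrite /preimage /= subrK.
by exists (x + a) => //; rewrite addrK.
Qed.

Lemma closure_shift A a :
  closure ((fun x => x + a) @^-1` A) = (fun x => x + a) @^-1` closure A.
Proof.
apply/seteqP; split=> x /closure_eballP cx; apply/closure_eballP => e /cx[y Ay xy].
  by exists (y + a) => //; rewrite opprD addrACA subrr addr0.
exists (y - a); first by rewrite /preimage /= subrK.
by rewrite addrAC -addrA -opprD.
Qed.

Lemma frontier_shift A a :
  frontier ((fun x => x + a) @^-1` A) = (fun x => x + a) @^-1` frontier A.
Proof.
rewrite /frontier closure_shift.
apply/seteqP; split=> x [cx ix]; split=> //.
- move=> /nbhs_eballP[e e0 eA]; apply: ix; apply/nbhs_eballP; exists e => // y xy.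
  by apply: eA; rewrite /eball /= opprD addrACA subrr addr0.
- move=> /nbhs_eballP[e e0 eA]; apply: ix; apply/nbhs_eballP; exists e => // y xy.
  rewrite -(subrK a y); apply: eA; move: xy.
  by rewrite /eball /= opprD addrA addrAC.
Qed.

Lemma closed_frontier A : closed (frontier A).
Proof.
rewrite /frontier setDE; apply: closedI; first exact: closed_closure.
by rewrite closedC; exact: open_interior.
Qed.

(** A point of the sphere is the limit of points on the segment from x. *)
Lemma sphere_sub_frontier x (r : R) : 0 < r ->
  [set y | enorm (y - x) = r] `<=` frontier (eball x r).
Proof.
move=> r0 y /= yr; split; last by move=> /interior_subset; rewrite /eball /= yr ltxx.
apply/closure_eballP => e e0.
pose t := Num.min 1 (e / (2 * r)).
have t0 : 0 < t by rewrite lt_min ltr01 divr_gt0// mulr_gt0.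
have t1 : t <= 1 by rewrite ge_min lexx.
have te : t * r < e.
  apply: (@le_lt_trans _ _ (e / 2)); last by rewrite ltr_pdivrMr// ltr_pMr// ltr1n.
  rewrite -ler_pdivlMr// (_ : e / 2 / r = e / (2 * r)).
    by rewrite ge_min lexx orbT.
  by field; rewrite gt_eqF.
exists (y - t *: (y - x)).
  rewrite /eball /= addrAC (_ : y - x - _ = (1 - t) *: (y - x)).
    rewrite enormZ yr ger0_norm ?subr_ge0//.
    by rewrite gtr_pMl// ltrBlDr ltrDl.
  by rewrite scalerBl scale1r.
by rewrite addrAC subrr sub0r enormN enormZ yr gtr0_norm.
Qed.

Lemma enorm_lower_bound (D : set 'rV[R]_n) x : closed D -> ~ D x ->
  exists2 e, 0 < e & forall y, D y -> e <= enorm (y - x).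
Proof.
move=> cD Dx; have /nbhs_eballP[e e0 eD] : nbhs x (~` D).
  by apply: open_nbhs_nbhs; split=> //; rewrite openC.
exists e => // y Dy; rewrite leNgt; apply/negP => yx.
exact: (eD y).
Qed.

End frontier.

Section kuran_integral.
Context (R : realType) (n : nat).
Notation T := (caratheodory_type (hausdorff_outer R n n.-1)).
Variables (D : set 'rV[R]_n) (x0 alpha : 'rV[R]_n) (K e : R).
Hypotheses (cD : closed D) (sD : (@sigma R n D < +oo)%E).
Hypothesis DK : forall y, D y -> enorm (y - x0) <= K.
Hypothesis e0 : 0 < e.
Hypothesis De : forall y, D y -> e <= enorm (y - alpha).

Let h (y : 'rV[R]_n) : R := kuran_h (alpha - x0) (y - x0).
Let phi (y : 'rV[R]_n) : R := dotp (alpha - y) (alpha - x0) / enorm (y - alpha) ^+ n.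

Lemma kuran_hE y : h y = enorm (alpha - x0) ^+ (n - 2) *
  ((enorm (y - x0) ^+ 2 - enorm (alpha - x0) ^+ 2) / enorm (y - alpha) ^+ n).
Proof. by rewrite /h /kuran_h opprB addrA subrK. Qed.

Let sigma_sub (a : 'rV[R]_n) i :
  measurable_fun [set: T] (fun y : 'rV[R]_n => (y - a) ord0 i).
Proof.
under eq_fun do rewrite !mxE.
exact: (measurable_funB (@sigma_coord R n i) (measurable_cst (a ord0 i))).
Qed.

Let sigma_subr (a : 'rV[R]_n) i :
  measurable_fun [set: T] (fun y : 'rV[R]_n => (a - y) ord0 i).
Proof.
under eq_fun do rewrite !mxE.
exact: (measurable_funB (measurable_cst (a ord0 i)) (@sigma_coord R n i)).
Qed.

Let sigma_enorm a : measurable_fun [set: T] (fun y : 'rV[R]_n => enorm (y - a)).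
Proof. by apply: measurable_enorm => i; exact: sigma_sub. Qed.

Let sigma_inv : measurable_fun [set: T]
  (fun y : 'rV[R]_n => (enorm (y - alpha) ^+ n)^-1).
Proof.
apply: measurable_inv; first by move=> y; rewrite exprn_ge0 ?enorm_ge0.
exact: (measurable_funX n (sigma_enorm alpha)).
Qed.

Lemma measurable_kuran_h : measurable_fun [set: T] h.
Proof.
rewrite (_ : h = fun y => enorm (alpha - x0) ^+ (n - 2) *
  ((enorm (y - x0) ^+ 2 - enorm (alpha - x0) ^+ 2) * (enorm (y - alpha) ^+ n)^-1)).
  have m2 := measurable_funX 2 (sigma_enorm x0).
  have m3 := measurable_funB m2 (measurable_cst (enorm (alpha - x0) ^+ 2)).
  exact: (measurable_funM (measurable_cst _) (measurable_funM m3 sigma_inv)).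
by apply/funext => y; exact: kuran_hE.
Qed.

Lemma measurable_flatness_kernel : measurable_fun [set: T] phi.
Proof.
have md : measurable_fun [set: T] (fun y : 'rV[R]_n => dotp (alpha - y) (alpha - x0)).
  by apply: measurable_dotp => i; [exact: sigma_subr|exact: measurable_cst].
exact: (measurable_funM md sigma_inv).
Qed.

Let integrable_le_cst (f : T -> R) C : measurable_fun setT f ->
  (forall y, D y -> `|f y| <= C) -> (@sigma R n).-integrable D (EFin \o f).
Proof.
move=> mf fC; apply: measurable_bounded_integrable => //.
- exact: closed_sigma.
- exact: measurable_funTS.
exists C; split; first by rewrite num_real.
by move=> M CM y Dy; exact: le_trans (fC y Dy) (ltW CM).
Qed.

Let inv_le y : D y -> 0 <= (enorm (y - alpha) ^+ n)^-1 <= (e ^+ n)^-1.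
Proof.
move=> Dy; have ye := lt_le_trans e0 (De Dy).
rewrite invr_ge0 exprn_ge0 ?enorm_ge0//= lef_pV2 ?posrE ?exprn_gt0//.
by apply: lerXn2r; rewrite ?nnegrE ?enorm_ge0 ?(ltW e0)// De.
Qed.

Lemma integrable_kuran_h : (@sigma R n).-integrable D (EFin \o h).
Proof.
apply: (@integrable_le_cst _ (enorm (alpha - x0) ^+ (n - 2) *
  ((K ^+ 2 + enorm (alpha - x0) ^+ 2) * (e ^+ n)^-1))).
  exact: measurable_kuran_h.
move=> y Dy; have /andP[i0 i1] := inv_le Dy.
rewrite kuran_hE normrM ger0_norm ?exprn_ge0 ?enorm_ge0//.
rewrite ler_wpM2l ?exprn_ge0 ?enorm_ge0// normrM (ger0_norm i0).
apply: ler_pM => //; apply: le_trans (ler_normB _ _) _.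
rewrite !ger0_norm ?sqr_ge0// lerD2r lerXn2r ?nnegrE ?enorm_ge0//.
  by rewrite (le_trans (enorm_ge0 (y - x0)))// DK.
exact: DK.
Qed.

Lemma integrable_flatness_kernel : (@sigma R n).-integrable D (EFin \o phi).
Proof.
apply: (@integrable_le_cst _
  ((K + enorm (alpha - x0)) * enorm (alpha - x0) * (e ^+ n)^-1)).
  exact: measurable_flatness_kernel.
move=> y Dy; have /andP[i0 i1] := inv_le Dy.
have ya : enorm (alpha - y) <= K + enorm (alpha - x0).
  rewrite (le_trans (enorm_dist_trans x0 _ _))// addrC lerD2r enorm_distC.
  exact: DK.
rewrite normrM (ger0_norm i0); apply: ler_pM => //.
apply: (@le_trans _ _ (enorm (alpha - y) * enorm (alpha - x0))); last first.
  by rewrite ler_wpM2r ?enorm_ge0.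
rewrite ler_norml dotp_le_enorm andbT lerNl -dotpNl.
by rewrite (le_trans (dotp_le_enorm _ _))// enormN.
Qed.

(** The difference of the two sides is |a|^(n-2) |y - alpha|^(2-n), where
    a = alpha - x0, as one sees by expanding |y - x0|^2 = |a + (y - alpha)|^2. *)
Lemma kuran_h_ge_kernel y : D y ->
  - (2 * enorm (alpha - x0) ^+ (n - 2)) * phi y <= h y.
Proof.
move=> Dy; have /andP[i0 i1] := inv_le Dy.
have E0 := lt_le_trans e0 (De Dy).
rewrite kuran_hE /phi -subr_ge0.
set rho := _ ^+ (n - 2); set w := (_ ^+ n)^-1 in i0 *.
have -> : enorm (y - x0) ^+ 2 = enorm (alpha - x0) ^+ 2
    - 2 * dotp (alpha - y) (alpha - x0) + enorm (y - alpha) ^+ 2.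
  rewrite (_ : y - x0 = (alpha - x0) - (alpha - y)); last first.
    by rewrite opprB [RHS]addrC addrA subrK.
  rewrite (enorm_distC y) !enorm_sqr !(dotpDl _ (- (alpha - y))) .
  rewrite !(dotpDr _ _ (- (alpha - y))) !dotpNl !dotpNr.
  rewrite (dotpC (alpha - x0) (alpha - y)); ring.
rewrite (_ : _ - _ = rho * (enorm (y - alpha) ^+ 2 * w)); last by ring.
by rewrite !mulr_ge0 ?exprn_ge0 ?enorm_ge0.
Qed.

(** Away from z the denominator is at least (rad / 2)^n, and the numerator
    |y - x0|^2 - |a|^2 is at least r^2 - |a|^2 for a = alpha - x0. *)
Lemma kuran_h_ge_far (r rad : R) (z y : 'rV[R]_n) : 0 <= r -> 0 < rad ->
  r <= enorm (y - x0) -> rad <= enorm (y - z) -> enorm (alpha - z) <= rad / 2 ->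
  - (enorm (alpha - x0) ^+ (n - 2) *
     (`|enorm (alpha - x0) ^+ 2 - r ^+ 2| * ((rad / 2) ^+ n)^-1)) <= h y.
Proof.
move=> r0 rad0 ry yz az.
have ya : rad / 2 <= enorm (y - alpha).
  have := enorm_dist_trans alpha y z; lra.
have rad20 : 0 < rad / 2 by rewrite divr_gt0.
have E0 := lt_le_trans rad20 ya.
rewrite kuran_hE -mulrN ler_wpM2l ?exprn_ge0 ?enorm_ge0//.
apply: (@le_trans _ _ (- `|enorm (alpha - x0) ^+ 2 - r ^+ 2| / enorm (y - alpha) ^+ n)).
  rewrite mulNr lerN2 ler_wpM2l// lef_pV2 ?posrE ?exprn_gt0//.
  by apply: lerXn2r; rewrite ?nnegrE ?enorm_ge0 ?(ltW rad20).
rewrite ler_wpM2r ?invr_ge0 ?exprn_ge0 ?enorm_ge0//.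
have : r ^+ 2 <= enorm (y - x0) ^+ 2 by apply: lerXn2r; rewrite ?nnegrE ?enorm_ge0.
have := ler_norm (enorm (alpha - x0) ^+ 2 - r ^+ 2); lra.
Qed.

(** Split D into its parts inside and outside the ball around z, and use
    [kuran_h_ge_kernel] on the former and [kuran_h_ge_far] on the latter. *)
Lemma kuran_integral_ge (r rad : R) (z : 'rV[R]_n) : 0 <= r -> 0 < rad ->
  (forall y, D y -> r <= enorm (y - x0)) -> enorm (alpha - z) <= rad / 2 ->
  ((- (2 * enorm (alpha - x0) ^+ (n - 2)))%:E *
     \int[sigma]_(y in D `&` eball z rad) (phi y)%:E -
   (enorm (alpha - x0) ^+ (n - 2) *
     (`|enorm (alpha - x0) ^+ 2 - r ^+ 2| * ((rad / 2) ^+ n)^-1))%:E * sigma D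
   <= \int[sigma]_(y in D) (h y)%:E)%E.
Proof.
move=> r0 rad0 Dr az.
set c := enorm _ ^+ _ * (_ * _); set b := - (2 * _).
have mD : measurable (D : set T) by exact: closed_sigma.
have mB : measurable (eball z rad : set T) by apply: open_sigma; exact: open_eball.
have mDB : measurable (D `&` eball z rad : set T) by exact: measurableI.
have mDC : measurable (D `\` eball z rad : set T) by exact: measurableD.
have c0 : 0 <= c.
  apply: mulr_ge0; first by rewrite exprn_ge0 ?enorm_ge0.
  by rewrite mulr_ge0// invr_ge0 exprn_ge0// divr_ge0// ltW.
have -> : (\int[sigma]_(y in D) (h y)%:E =
    \int[sigma]_(y in D `&` eball z rad) (h y)%:E +
    \int[sigma]_(y in D `\` eball z rad) (h y)%:E)%E.
  have mh : measurable_fun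
      ((D `&` eball z rad) `|` (D `\` eball z rad) : set T) (EFin \o h).
    by apply/measurable_EFinP; apply: measurable_funTS; exact: measurable_kuran_h.
  rewrite -(integral_setU _ mDB mDC mh) ?setUIDK//.
  by apply/disj_setPS => y [[_ ?] []].
apply: leeD.
  have iphi := integrableS mD mDB (@subIsetl _ _ _) integrable_flatness_kernel.
  have ih := integrableS mD mDB (@subIsetl _ _ _) integrable_kuran_h.
  rewrite -(integralZl mDB iphi); apply: (le_integral mDB (integrableZl mDB b iphi) ih).
  by move=> y /[!inE] -[Dy _]; rewrite -EFinM lee_fin; exact: kuran_h_ge_kernel.
have ih := integrableS mD mDC (@subDsetl _ _ _) integrable_kuran_h.
have sDC : (@sigma R n (D `\` eball z rad) <= @sigma R n D)%E.
  exact: (le_outer_measure (hausdorff_outer R n n.-1) _ _ (@subDsetl _ _ _)).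
apply: (@le_trans _ _ (\int[sigma]_(y in D `\` eball z rad) (cst (- c)%:E y))%E).
  by rewrite (integral_cst _ mDC) EFinN mulNe leeN2 lee_wpmul2l// lee_fin.
have ic : (@sigma R n).-integrable (D `\` eball z rad) (EFin \o cst (- c)).
  apply: measurable_bounded_integrable; [exact: mDC| |exact: measurable_cst|].
    exact: le_lt_trans sDC sD.
  exists `|- c|; split; first by rewrite num_real.
  by move=> M CM y _; exact: ltW CM.
apply: (le_integral mDC ic ih) => y /[!inE] -[Dy yz]; rewrite lee_fin.
have ry : rad <= enorm (y - z) by rewrite leNgt; apply/negP.
exact: kuran_h_ge_far r0 rad0 (Dr y Dy) ry az.
Qed.

End kuran_integral.

(** * From spherical flatness to the Kuran gap *)

Section witness.
Context (R : realType) (n : nat).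
Hypothesis hn : (2 <= n)%N.
Variables (Omega : set 'rV[R]_n) (x0 z : 'rV[R]_n).

(** Unfolds the two lower limits: as the flatness is below 1 + epsilon, some
    radius has an inner lower limit below the bound, and then every
    neighbourhood of z contains an exterior point at which the integral is
    below it. An inner lower limit over no exterior point is +oo, and is thus
    excluded. *)
Lemma flatness_witness eps : 0 < enorm (z - x0) ->
  (spherical_flatness Omega x0 z <= 1)%E -> 0 < eps ->
  exists2 rad, 0 < rad & forall V, nbhs z V ->
   exists2 alpha, V alpha /\ ~ closure Omega alpha &
   (\int[sigma]_(x in frontier Omega `&` eball z rad)
     (dotp (alpha - x) (alpha - x0) / enorm (x - alpha) ^+ n)%:E <
    (n%:R * omega R n * enorm (z - x0) / 2 + eps)%:E)%E.
Proof.
move=> r0; rewrite /spherical_flatness; set L := limf_einf _ _.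
set c := n%:R * _ * _ => cL eps0.
have c0 : 0 < c by rewrite !mulr_gt0 ?omega_gt0// ltr0n (leq_trans _ hn).
have {}cL : (L < (c / 2 + eps)%:E)%E.
  apply: (@le_lt_trans _ _ (c / 2)%:E); last by rewrite lte_fin ltrDl.
  rewrite -invf_div -[X in (_ <= X)%E]mule1 lee_pdivlMl// divr_gt0//.
have low (X : choiceType) (T : filteredType X) (F : set_system T)
    (f : T -> \bar R) (V : set T) :
    F V -> (limf_einf f F < (c / 2 + eps)%:E)%E ->
    exists2 t, V t & (f t < (c / 2 + eps)%:E)%E.
  move=> FV; rewrite limf_einfE => fc.
  have : (ereal_inf (f @` V) < (c / 2 + eps)%:E)%E.
    by apply: le_lt_trans fc; apply: ereal_sup_ubound; exists V.
  by move=> /ereal_inf_lt[_ [t Vt <-] tc]; exists t.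
have [rad rad0 {}cL] := low _ _ _ _ _ (nbhs_right_gt (0 : R)) cL.
exists rad => // V zV.
have WV : within (~` closure Omega) (nbhs z) (V `&` ~` closure Omega).
  by apply: filterS zV => x Vx Cx.
by have [alpha [Va Ca] ac] := low _ _ _ _ _ WV cL; exists alpha.
Qed.

(** The pole alpha of the Kuran function contributes -1 at the centre. *)
Lemma kuran_fun0 (a : 'rV[R]_n) : 0 < enorm a -> kuran_fun a 0 = 0.
Proof.
move=> a0; rewrite /kuran_fun /kuran_h enorm0 sub0r enormN expr0n /= sub0r.
have nE : enorm a ^+ n = enorm a ^+ (n - 2) * enorm a ^+ 2 by rewrite -exprD subnK.
rewrite nE; set u := enorm a ^+ (n - 2).
have u0 : u != 0 by rewrite gt_eqF// exprn_gt0.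
by field; rewrite u0 gt_eqF.
Qed.

Lemma surface_average_shift (a : 'rV[R]_n) :
  (sigma (frontier Omega) < +oo)%E ->
  (@sigma R n).-integrable (frontier Omega) (fun y => (kuran_h a (y - x0))%:E) ->
  measurable_fun [set: caratheodory_type (hausdorff_outer R n n.-1)]
    (fun y => kuran_h a (y - x0)) ->
  surface_average [set x - x0 | x in Omega] (kuran_fun a) =
  ((sigma (frontier Omega))^-1 * (sigma (frontier Omega) +
    \int[sigma]_(y in frontier Omega) (kuran_h a (y - x0))%:E))%E.
Proof.
move=> sD ih mh; rewrite /surface_average image_sub_preimage frontier_shift.
set D := frontier Omega.
have mD := closed_sigma (@closed_frontier _ _ Omega).
have -> : sigma ((fun x => x + x0) @^-1` D) = sigma D by exact: hausdorff_shift.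
congr (_ * _)%E.
transitivity (\int[sigma]_(y in D) (1 + kuran_h a (y - x0))%:E)%E.
  rewrite -(sigma_integral_shift x0 mD); last first.
    by apply: (measurable_funD _ mh); exact: measurable_cst.
  by apply: eq_integral => x _; rewrite addrK.
under eq_integral do rewrite EFinD.
rewrite (integralD mD); last 2 first.
- apply: measurable_bounded_integrable; [exact: mD|exact: sD|exact: measurable_cst|].
  exists 1; split; first by rewrite num_real.
  by move=> M M1 y _; rewrite normr1 ltW.
- exact: ih.
by rewrite (integral_cst _ mD) mul1e.
Qed.

End witness.

Lemma sphere_le_sigma (R : realType) n (x0 : 'rV[R]_n) r : (0 < n)%N -> 0 < r ->
  ((n%:R * omega R n * r ^+ n.-1)%:E <= sigma (frontier (eball x0 r)))%E.
Proof.
case: n x0 => // m x0 _ r0; apply: le_trans (sphere_le_hausdorff m r0) _.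
rewrite -(hausdorff_shift m (- x0)); apply: le_hausdorff => x xr.
exact: sphere_sub_frontier r0 _ xr.
Qed.

Lemma bounded_enorm (R : realType) n (A : set 'rV[R]_n) (x0 : 'rV[R]_n) :
  bounded_set A -> exists K, forall y, frontier A y -> enorm (y - x0) <= K.
Proof.
move=> [M [_ AM]]; pose N := `|M| + 2.
have AN x : A x -> enorm x <= n%:R * N.
  move=> Ax; rewrite -enormN -sub0r; apply: ball_le_enorm.
  rewrite mx_norm_ball /ball_ /= sub0r normrN.
  apply: (@le_lt_trans _ _ (`|M| + 1)); last by rewrite ltrD2l ltr1n.
  by apply: AM => //; rewrite (le_lt_trans (ler_norm M))// ltrDl.
exists (1 + n%:R * N + enorm x0) => y [/closure_eballP/(_ 1 ltr01)[x Ax xy] _].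
have := enorm_dist_trans x y x0; have := enormD x (- x0); rewrite enormN.
have := AN x Ax; rewrite (enorm_distC y x); lra.
Qed.

Section gap.
Context (R : realType) (n : nat).
Hypothesis hn : (2 <= n)%N.
Variables (Omega : set 'rV[R]_n) (x0 z : 'rV[R]_n).
Hypotheses (Ob : bounded_set Omega) (Ox0 : Omega x0).
Hypothesis sD : (sigma (frontier Omega) < +oo)%E.
Let r := enorm (z - x0).
Hypotheses (r0 : 0 < r).
Hypothesis Dr : forall y, frontier Omega y -> r <= enorm (y - x0).
Hypothesis flat : (spherical_flatness Omega x0 z <= 1)%E.
Hypothesis s0 : (0 < sigma (frontier Omega))%E.
Let s := fine (sigma (frontier Omega)).
Let L := n%:R * omega R n * r ^+ n.-1.

(** A single alpha, close enough to the touching point, realizes the bound up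
    to eta. *)
Lemma kuran_gap_ge_eps eta : 0 < eta ->
  ((1 - (L + eta) / s)%:E <= kuran_gap Omega x0)%E.
Proof.
move=> eta0.
have sE : sigma (frontier Omega) = s%:E by rewrite fineK// ge0_fin_numE// ltW.
have sp : 0 < s by rewrite -lte_fin -sE.
have [K DK] := bounded_enorm x0 Ob.
have rn0 : 0 < r ^+ (n - 2) by rewrite exprn_gt0.
(* chosen so that G r below is n omega_n r^(n-1) + eta / 2 *)
pose eps := eta / (4 * r ^+ (n - 2)).
have eps0 : 0 < eps by rewrite divr_gt0// mulr_gt0.
pose M := n%:R * omega R n * r / 2 + eps.
have [rad rad0 wit] := flatness_witness hn r0 flat eps0.
(* the bound of kuran_integral_ge, as a function of rho = |alpha - x0| *)
pose G (rho : R) := 2 * rho ^+ (n - 2) * M +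
  rho ^+ (n - 2) * (`|rho ^+ 2 - r ^+ 2| * ((rad / 2) ^+ n)^-1) * s.
have Gr : G r < L + eta.
  rewrite /G subrr normr0 mul0r mulr0 mul0r addr0 /M /L.
  have -> : r ^+ n.-1 = r ^+ (n - 2) * r.
    by rewrite -exprSr; congr (_ ^+ _); rewrite -subn1 -subSn.
  rewrite [ltLHS](_ : _ = n%:R * omega R n * (r ^+ (n - 2) * r) + eta / 2).
    by rewrite ltrD2l ltr_pdivrMr// ltr_pMr// ltr1n.
  by rewrite /eps; field; rewrite gt_eqF.
have Gc : G rho @[rho --> r] --> G r.
  have cX k : rho ^+ k @[rho --> r] --> r ^+ k by exact: exprn_continuous.
  apply: cvgD.
    by apply: cvgM; [apply: cvgM; [exact: cvg_cst|exact: cX]|exact: cvg_cst].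
  apply: cvgM; last exact: cvg_cst.
  apply: cvgM; first exact: cX.
  apply: cvgM; last exact: cvg_cst.
  apply: cvg_norm; apply: cvgB; [exact: cX|exact: cvg_cst].
have /nbhs_ballP[e1 /= e10 e1G] : \forall rho \near r, G rho < L + eta.
  exact: cvgr_lt Gc _ Gr.
have rad20 : 0 < rad / 2 by rewrite divr_gt0.
have m0 : 0 < Num.min e1 (rad / 2) by rewrite lt_min e10.
have [alpha [za Ca] aI] := wit _ (nbhs_eball z m0).
have {za}/andP[za1 za2] : (enorm (alpha - z) < e1) && (enorm (alpha - z) < rad / 2).
  by rewrite -lt_min.
set rho := enorm (alpha - x0).
have rho0 : 0 < rho.
  rewrite /rho enorm_gt0 subr_eq0; apply/eqP => ax; apply: Ca; rewrite ax.
  exact: subset_closure.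
have Grho : G rho < L + eta.
  apply: e1G; rewrite /ball /= distrC; apply: le_lt_trans (enorm_dist _ _) _.
  by rewrite opprB addrA subrK.
have cD := @closed_frontier _ _ Omega.
have [e e0 De] := @enorm_lower_bound _ _ _ alpha cD (fun h => Ca h.1).
have ih := integrable_kuran_h cD sD DK e0 De.
have iphi := integrable_flatness_kernel cD sD DK e0 De.
have mD := closed_sigma cD.
have mB : measurable (eball z rad : set (caratheodory_type (hausdorff_outer R n n.-1))).
  by apply: open_sigma; exact: open_eball.
have iI := integrableS mD (measurableI _ _ mD mB) (@subIsetl _ _ _) iphi.
have := kuran_integral_ge cD sD DK e0 De (ltW r0) rad0 Dr (ltW za2).
have Jfin := integrable_fin_num mD ih.
have Ifin := integrable_fin_num (measurableI _ _ mD mB) iI.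
set J := (\int[sigma]_(y in frontier Omega) _)%E in Jfin *.
set I := (\int[sigma]_(y in frontier Omega `&` _) _)%E in Ifin aI *.
rewrite sE -(fineK Jfin) -(fineK Ifin) -/rho -!EFinM -EFinB lee_fin => IJ.
have {}aI : fine I < M by rewrite -lte_fin fineK.
have JG : - G rho <= fine J.
  apply: le_trans IJ; rewrite /G opprD lerD2r mulNr lerN2.
  by apply: ler_wpM2l; [rewrite mulr_ge0// exprn_ge0// ltW|exact: ltW].
pose Omega' := [set x - x0 | x in Omega].
have avg : surface_average Omega' (kuran_fun (alpha - x0)) =
    (s^-1 * (s + fine J))%:E.
  rewrite (surface_average_shift sD ih (measurable_kuran_h x0 alpha)) -/J.
  by rewrite sE inver gt_eqF// -(fineK Jfin) -EFinD -EFinM.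
apply: (@le_trans _ _ (`|(kuran_fun (alpha - x0)%R 0%R)%:E -
    surface_average Omega' (kuran_fun (alpha - x0)%R)|)%E); last first.
  apply: ereal_sup_ubound; exists (alpha - x0) => //=.
  by rewrite /Omega' image_sub_preimage closure_shift /preimage /= subrK.
rewrite kuran_fun0// avg sub0e abseN /= lee_fin.
apply: le_trans (ler_norm _).
rewrite mulrDr mulVf ?gt_eqF// -mulNr (mulrC s^-1) lerD2l ler_wpM2r ?invr_ge0 ?(ltW sp)//.
by apply: le_trans JG; rewrite lerN2 ltW.
Qed.

Lemma kuran_gap_ge : ((1 - L / s)%:E <= kuran_gap Omega x0)%E.
Proof.
have sE : sigma (frontier Omega) = s%:E by rewrite fineK// ge0_fin_numE// ltW.
have sp : 0 < s by rewrite -lte_fin -sE.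
apply/lee_addgt0Pr => t t0; have ts : 0 < t * s by rewrite mulr_gt0.
apply: le_trans (leeD2r _ (kuran_gap_ge_eps ts)).
rewrite -EFinD lee_fin le_eqVlt; apply/orP; left; apply/eqP; field.
by rewrite gt_eqF.
Qed.

End gap.

Theorem corollary1p8 (R : realType) (n : nat) (hn : (2 <= n)%N)
    (Omega : set 'rV[R]_n) (x0 : 'rV[R]_n)
    (Omega_bounded : bounded_set Omega) (Omega_open : open Omega)
    (Omega_surface : (sigma (frontier Omega) < +oo)%E)
    (Omega_x0 : Omega x0)
    (flat : exists z : 'rV[R]_n, touching Omega x0 z /\
       (spherical_flatness Omega x0 z <= 1)%E) :
  let r := edistance x0 (frontier Omega) in
  let B := eball x0 r in
  (kuran_gap Omega x0 >=
     (sigma (frontier Omega) - sigma (frontier B)) / sigma (frontier Omega))%E.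
Proof.
lazy zeta; set r := edistance x0 (frontier Omega); set B := eball x0 r.
have [z [[Dz zr] Sz]] := flat.
have rE : r = enorm (z - x0) by rewrite /r -zr enorm_distC.
have r0 : 0 < r.
  rewrite rE enorm_gt0 subr_eq0; apply/eqP => zx; case: Dz => _; apply.
  by rewrite zx; apply: open_nbhs_nbhs.
have Dr y : frontier Omega y -> r <= enorm (y - x0).
  move=> Dy; rewrite enorm_distC; apply: ge_inf; last by exists y.
  by exists 0 => _ [w _ <-]; exact: enorm_ge0.
have LB := sphere_le_sigma x0 (ltnW hn) r0.
rewrite -/B in LB; set L := _ * _ in LB.
have L0 : 0 < L by rewrite !mulr_gt0 ?omega_gt0 ?exprn_gt0// ltr0n ltnW.
have sge0 : (0 <= sigma (frontier Omega))%E by exact: measure_ge0.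
have sE : sigma (frontier Omega) = (fine (sigma (frontier Omega)))%:E.
  by rewrite fineK// ge0_fin_numE.
have B0 : (0 < sigma (frontier B))%E by apply: lt_le_trans LB; rewrite lte_fin.
(* a boundary of measure 0 makes the left-hand side -oo, as B0 holds and 0^-1 = +oo *)
have [s0|sN0] := eqVneq (sigma (frontier Omega)) 0%E.
  by rewrite s0 inve0 sub0e lt0_muley ?leNye// oppe_lt0.
have s0 : (0 < sigma (frontier Omega))%E by rewrite lt0e sN0.
have sp : 0 < fine (sigma (frontier Omega)) by rewrite -lte_fin -sE.
rewrite rE in Dr r0.
have := kuran_gap_ge hn Omega_bounded Omega_x0 Omega_surface r0 Dr Sz s0.
apply: le_trans; rewrite sE inver gt_eqF// -rE.
have [sB|sB] := eqVneq (sigma (frontier B)) +oo%E.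
  by rewrite sB /= gt0_mulNye ?leNye// lte_fin invr_gt0.
have BE : sigma (frontier B) = (fine (sigma (frontier B)))%:E.
  by rewrite fineK// ge0_fin_numE ?ltey// ltW.
rewrite BE -EFinB -EFinM lee_fin mulrBl divff ?gt_eqF// lerD2l lerN2.
by rewrite ler_wpM2r ?invr_ge0 ?(ltW sp)// -lee_fin -BE.
Qed.
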